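(* Let $1\le r\le n$ be integers. Let $I=\{i_1<\cdots<i_r\}$, $J=\{j_1<\cdots<j_r\}$, $K=\{k_1<\cdots<k_r\}$ be subsets of $\{1,\dots,n\}$ such that $(I,J,K)$ has property P$_n$ (respectively, property AP$_n$). Set $i_0=j_0=k_0=0$ and suppose $u,v,w\in\{0,1,\dots,r\}$ satisfy $$i_u+j_v+k_w\le n.$$ For $y\in\{1,\dots,r\}$ set $i'_y=i_y+h_u(y)$, $j'_y=j_y+h_v(y)$, $k'_y=k_y+h_w(y)$, where $h_x(y)=0$ if $y\le x$ and $h_x(y)=1$ if $y>x$, and let $I'=\{i'_1,\dots,i'_r\}$, $J'=\{j'_1,\dots,j'_r\}$, $K'=\{k'_1,\dots,k'_r\}$. Then $(I',J',K')$ has property P$_{n+1}$ (respectively, property AP$_{n+1}$).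
   Context: A finite von Neumann algebra $(\mathcal M,\tau)$ means a von Neumann algebra $\mathcal M$ with a fixed normal, faithful, tracial state $\tau$; it is diffuse if it has no minimal nonzero projections. A flag in a diffuse finite von Neumann algebra $(\mathcal M,\tau)$ is a linearly ordered family $e=(e_t)_{0\le t\le1}$ of projections in $\mathcal M$ (increasing in $t$) such that $\tau(e_t)=t$ for all $t$. For projections $p,q$, $p\wedge q$ is the projection onto the intersection of their ranges. Let $I=\{i_1<\cdots<i_r\}$, $J=\{j_1<\cdots<j_r\}$, $K=\{k_1<\cdots<k_r\}$ be subsets of $\{1,\dots,n\}$. The triple $(I,J,K)$ has property P$_n$ if whenever $e,f,g$ are flags in any finite von Neumann algebra $(\mathcal M,\tau)$ there is a projection $p\in\mathcal M$ with $\tau(p)=\frac rn$ and, for all $\ell\in\{1,\dots,r\}$, $$\tau(e_{i_\ell/n}\wedge p)\ge\tfrac\ell n,\quad \tau(f_{j_\ell/n}\wedge p)\ge\tfrac\ell n,\quad \tau(g_{k_\ell/n}\wedge p)\ge\tfrac\ell n.\qquad( * )$$ It has property AP$_n$ if whenever $e,f,g$ are flags in any finite von Neumann algebra $(\mathcal M,\tau)$ and $\varepsilon>0$, there is a projection $p\in\mathcal M$ with $\tau(p)\le\frac rn+\varepsilon$ such that $( * )$ holds for all $\ell\in\{1,\dots,r\}$. *)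

(* Defs.v *)
From mathcomp Require Import all_boot all_order all_algebra.
From mathcomp Require Import all_classical all_reals all_analysis.
From mathcomp Require Import complex sesquilinear.

Set Implicit Arguments.
Unset Strict Implicit.
Unset Printing Implicit Defensive.

Import Order.TTheory GRing.Theory Num.Theory.
Import numFieldNormedType.Exports.

Local Open Scope classical_set_scope.
Local Open Scope ring_scope.
Local Open Scope complex_scope.

(* The inner product is linear in its first argument.  The norm of a module
   over [R[i]] takes its values in [R[i]]; the order there is
   [x <= y] iff [y - x] is a nonnegative real. *)
Record hilbertSpace (R : realType) := HilbertSpace {
  hcarrier :> completeNormedModType R[i] ;
  hdot : {dot hcarrier for (@Num.conj R[i])} ;
  hnormE : forall x : hcarrier, `|x| ^+ 2 = hdot x x }.

Section Operators.
Variables (R : realType) (H : hilbertSpace R).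
Implicit Types (S T P Q : H -> H) (M A : set (H -> H)).

Definition bounded_op T : Prop :=
  linear T /\ exists C : R[i], forall x, `|T x| <= C * `|x|.

Definition adjoint_of T S : Prop :=
  forall x y, hdot H (T x) y = hdot H x (S y).

Definition selfadjoint T : Prop := bounded_op T /\ adjoint_of T T.

Definition op_le S T : Prop := forall x, hdot H (S x) x <= hdot H (T x) x.

Definition projection P : Prop := selfadjoint P /\ P \o P = P.

(* The projection onto [V]; meaningful only when [V] is a closed subspace. *)
Definition proj_onto (V : set H) : H -> H :=
  xget (fun=> 0) [set P | projection P /\ range P = V].

Definition proj_meet P Q : H -> H := proj_onto (range P `&` range Q).

Definition commutant A : set (H -> H) :=
  [set S | bounded_op S /\ forall T, A T -> S \o T = T \o S].

(* The last field is the bicommutant form of closedness in the weak operator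
   topology. *)
Record von_neumann_algebra M : Prop := {
  vna_bounded : M `<=` bounded_op ;
  vna_id : M idfun ;
  vna_linear : forall (a : R[i]) S T, M S -> M T -> M (fun x => a *: S x + T x) ;
  vna_comp : forall S T, M S -> M T -> M (S \o T) ;
  vna_adjoint : forall T, M T -> exists2 S, M S & adjoint_of T S ;
  vna_bicommutant : commutant (commutant M) = M }.

Definition sa_part M : set (H -> H) := [set T | M T /\ selfadjoint T].

Definition op_lub M (D : set (H -> H)) T : Prop :=
  [/\ sa_part M T,
      forall S, D S -> op_le S T &
      forall U, sa_part M U -> (forall S, D S -> op_le S U) -> op_le T U].

Definition directed (D : set (H -> H)) : Prop :=
  D !=set0 /\
  forall S T, D S -> D T -> exists U, [/\ D U, op_le S U & op_le T U].

(* [tau] is defined on all functions, but only its values on [M] matter. *)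
Record normal_faithful_tracial_state M (tau : (H -> H) -> R[i]) : Prop := {
  tau_linear : forall (a : R[i]) S T, M S -> M T ->
    tau (fun x => a *: S x + T x) = a * tau S + tau T ;
  tau_ge0 : forall T, M T -> op_le (fun=> 0) T -> 0 <= tau T ;
  tau_id : tau idfun = 1 ;
  tau_tracial : forall S T, M S -> M T -> tau (S \o T) = tau (T \o S) ;
  tau_faithful : forall T, M T -> op_le (fun=> 0) T -> tau T = 0 -> T = fun=> 0 ;
  tau_normal : forall D T, D `<=` sa_part M -> directed D -> op_lub M D T ->
    supremums [set tau S | S in D] (tau T) }.

Definition finite_vna M (tau : (H -> H) -> R[i]) : Prop :=
  von_neumann_algebra M /\ normal_faithful_tracial_state M tau.

Definition minimal_projection M P : Prop :=
  [/\ M P, projection P, P <> (fun=> 0) &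
      forall Q, M Q -> projection Q -> op_le Q P -> Q = (fun=> 0) \/ Q = P].

Definition diffuse M : Prop := ~ exists P, minimal_projection M P.

(* Only the values [e t] for [0 <= t <= 1] matter. *)
Definition flag M (tau : (H -> H) -> R[i]) (e : R -> H -> H) : Prop :=
  [/\ forall t, 0 <= t <= 1 -> M (e t) /\ projection (e t),
      forall s t, 0 <= s -> s <= t -> t <= 1 -> op_le (e s) (e t) &
      forall t, 0 <= t <= 1 -> tau (e t) = t%:C].

End Operators.

(* An [r]-element subset of {1, ..., n}, listed in increasing order. *)
Record rsubset (n r : nat) := RSubset {
  elts :> seq nat ;
  eltsP : [&& size elts == r, sorted ltn elts
            & all (fun a => (0 < a <= n)%N) elts] }.

(* [ith I l] is i_l for 1 <= l <= r, and i_0 = 0. *)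
Definition ith n r (I : rsubset n r) (l : nat) : nat := nth 0%N (0%N :: I) l.

Definition hstep (x y : nat) : nat := if (y <= x)%N then 0%N else 1%N.

Definition raise_seq n r (x : nat) (I : rsubset n r) : seq nat :=
  [seq (ith I y + hstep x y)%N | y <- iota 1 r].

Lemma raise_subproof n r (x : nat) (I : rsubset n r) :
  [&& size (raise_seq x I) == r, sorted ltn (raise_seq x I)
    & all (fun a => (0 < a <= n.+1)%N) (raise_seq x I)].
Proof.
case: I => s sP; have /and3P[/eqP szs srt /allP bnd] := sP.
have mem l : (1 <= l <= r)%N -> nth 0%N s l.-1 \in s.
  by case: l => //= l lr; rewrite mem_nth ?szs.
apply/and3P; split; first by rewrite size_map size_iota.
- have mono : {in [pred y | (0 < y <= r)%N] &, {homo
      (fun y => ith (RSubset sP) y + hstep x y)%N : y z / (y < z)%N}}.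
    move=> [//|y] [//|z]; rewrite !inE /ith /= => yr zr yz.
    have lt_yz : (nth 0%N s y < nth 0%N s z)%N.
      by apply: (sorted_ltn_nth ltn_trans) => //; rewrite inE szs.
    rewrite -addSn leq_add // /hstep.
    case: (leqP y.+1 x) => //= xy; case: (leqP z.+1 x) => // zx.
    by have := ltn_trans (leq_trans zx xy) yz; rewrite ltnn.
  apply: (homo_sorted_in mono); last exact: iota_ltn_sorted.
  by apply/allP => y; rewrite mem_iota add1n ltnS inE.
- apply/allP => _ /mapP[y + ->]; rewrite mem_iota add1n ltnS /ith /= => yr.
  case: y yr => [//|y] yr /=; have /andP[h1 h2] := bnd _ (mem _ yr).
  by rewrite addn_gt0 h1 /= -(addn1 n); apply: leq_add => //; rewrite /hstep; case: ifP.
Qed.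

(* The set I' = {i_y + h_x(y) : 1 <= y <= r}. *)
Definition raise n r (x : nat) (I : rsubset n r) : rsubset n.+1 r :=
  RSubset (raise_subproof x I).

Section Properties.
Variables (R : realType) (n r : nat).

Definition meets_flag (H : hilbertSpace R) (tau : (H -> H) -> R[i])
    (e : R -> H -> H) (I : rsubset n r) (p : H -> H) : Prop :=
  forall l, (1 <= l <= r)%N ->
    l%:R / n%:R <= tau (proj_meet (e ((ith I l)%:R / n%:R)) p).

Definition property_P (I J K : rsubset n r) : Prop :=
  forall (H : hilbertSpace R) (M : set (H -> H)) (tau : (H -> H) -> R[i]),
    finite_vna M tau -> diffuse M ->
  forall e f g : R -> H -> H,
    flag M tau e -> flag M tau f -> flag M tau g ->
  exists p : H -> H,
    [/\ M p, projection p, tau p = r%:R / n%:R &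
        [/\ meets_flag tau e I p, meets_flag tau f J p
          & meets_flag tau g K p]].

Definition property_AP (I J K : rsubset n r) : Prop :=
  forall (H : hilbertSpace R) (M : set (H -> H)) (tau : (H -> H) -> R[i]),
    finite_vna M tau -> diffuse M ->
  forall e f g : R -> H -> H,
    flag M tau e -> flag M tau f -> flag M tau g ->
  forall eps : R, 0 < eps ->
  exists p : H -> H,
    [/\ M p, projection p, tau p <= r%:R / n%:R + eps%:C &
        [/\ meets_flag tau e I p, meets_flag tau f J p
          & meets_flag tau g K p]].

End Properties.

(* Main.v *)
(* The union of [e_(i_u/(n+1))], [f_(j_v/(n+1))] and [g_(k_w/(n+1))] has trace at
   most [n/(n+1)], so some projection [q] of trace exactly [n/(n+1)] dominates all
   three.  In the corner [q M q], with its trace renormalized, [t |-> tau (q /\ e_t)]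
   increases continuously from [0] to [n/(n+1)], so reparametrizing [q /\ e_t] by its
   trace gives a flag [e'] with [e'_(i/n) <= e_((i+1)/(n+1))], and even
   [e'_(i/n) <= e_(i/(n+1))] when [i <= i_u].  A projection for [e', f', g'] in the
   corner is the required projection of [M].

   Continuity comes from [tau (p /\ q) >= tau p + tau q - 1]: the meet is the strong
   limit of [(p q p)^k], and for [k >= 1] the difference
   [tau ((p q p)^k) - tau ((q' p' q')^k)], where [p' = 1 - p] and [q' = 1 - q], does
   not depend on [k].  The corner trace is normal because least upper bounds of
   directed families are strong limits (Vigier), hence agree in [M] and in [q M q]. *)
Require Import Defs.
From HB Require Import structures.
From mathcomp Require Import all_boot all_order all_algebra.
From mathcomp Require Import all_classical all_reals all_analysis.
From mathcomp Require Import complex sesquilinear ring lra zify.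

Set Implicit Arguments.
Unset Strict Implicit.
Unset Printing Implicit Defensive.

Import Order.TTheory GRing.Theory Num.Theory.
Import numFieldNormedType.Exports.

Local Open Scope classical_set_scope.
Local Open Scope ring_scope.
Local Open Scope complex_scope.

(** The constant in [bounded_op] is an arbitrary element of [R[i]]; later estimates divide by it, so
    it is replaced by a positive one. *)
Lemma bounded_opP (R : realType) (H : hilbertSpace R) (T : H -> H) : bounded_op T ->
  exists2 C : R[i], 0 < C & forall x, `|T x| <= C * `|x|.
Proof.
move=> [_ [C TC]]; exists (`|C| + 1); first by rewrite ltr_wpDl.
move=> x; rewrite mulrDl mul1r ler_wpDr// (le_trans (TC x))//.
have /ger0_norm <- : 0 <= C * `|x| by exact: le_trans (TC x).
by rewrite normrM normr_id.
Qed.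


(** * Hilbert spaces and quadratic forms *)

Section HilbertSpace.
Variables (R : realType) (H : hilbertSpace R).
Implicit Types (x y z : H) (a b : R[i]) (S T : H -> H).
Local Notation "'[ x , y ]" := (hdot H x y).

Lemma dotDl x y z : '[x + y, z] = '[x, z] + '[y, z].
Proof. exact: linearDl. Qed.
Lemma dotDr x y z : '[x, y + z] = '[x, y] + '[x, z].
Proof. exact: linearDr. Qed.
Lemma dotBl x y z : '[x - y, z] = '[x, z] - '[y, z].
Proof. exact: linearBl. Qed.
Lemma dotBr x y z : '[x, y - z] = '[x, y] - '[x, z].
Proof. exact: linearBr. Qed.
Lemma dotNl x y : '[- x, y] = - '[x, y].
Proof. exact: linearNl. Qed.
Lemma dotNr x y : '[x, - y] = - '[x, y].
Proof. exact: linearNr. Qed.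
Lemma dot0l x : '[0, x] = 0.
Proof. exact: linear0l. Qed.
Lemma dot0r x : '[x, 0] = 0.
Proof. exact: linear0r. Qed.
Lemma dotZl a x y : '[a *: x, y] = a * '[x, y].
Proof. exact: linearZl_LR. Qed.
Lemma dotZr a x y : '[x, a *: y] = Num.conj a * '[x, y].
Proof. exact: linearZr_LR. Qed.
Lemma dotC x y : '[x, y] = Num.conj '[y, x].
Proof. by rewrite [LHS]hermC expr0 mul1r. Qed.
Lemma dot_ge0 x : 0 <= '[x, x].
Proof. by rewrite -hnormE exprn_ge0. Qed.
Lemma dot_eq0 x : '[x, x] = 0 -> x = 0.
Proof. by rewrite -hnormE => /eqP; rewrite sqrf_eq0 normr_eq0 => /eqP. Qed.

Lemma dot_eq0r x : (forall y, '[x, y] = 0) -> x = 0.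
Proof. by move=> /(_ x)/dot_eq0. Qed.

Lemma Cauchy_Schwarz x y : `|'[x, y]| <= `|x| * `|y|.
Proof.
have [->|y0] := eqVneq y 0; first by rewrite dot0r !normr0 mulr0.
have ny0 : 0 < `|y| by rewrite normr_gt0.
rewrite -(@ler_pXn2r _ 2)// ?nnegrE ?mulr_ge0//.
rewrite exprMn !hnormE.
have yy0 : 0 < '[y, y] by rewrite -hnormE exprn_gt0.
have yyc : Num.conj '[y, y] = '[y, y] by apply/CrealP; exact: gtr0_real.
have := dot_ge0 (x - ('[x, y] / '[y, y]) *: y).
rewrite dotBl !dotBr !dotZl !dotZr rmorphM/= fmorphV/= yyc (dotC y x) normCK.
set a := '[x, y]; set b := Num.conj a; set n := '[y, y].
have -> : '[x, x] - b / n * a - (a / n * b - a / n * (b / n * n)) = '[x, x] - a * b / n.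
  by field; rewrite gt_eqF.
by rewrite subr_ge0 ler_pdivrMr.
Qed.

End HilbertSpace.

Lemma linearTP (R : realType) (H : hilbertSpace R) (T : H -> H) : linear T ->
  [/\ T 0 = 0, {morph T : x y / x + y}, {morph T : x y / x - y},
      {morph T : x / - x} & forall a, {morph T : x / a *: x}].
Proof.
move=> lT; have T0 : T 0 = 0.
  by have := lT (-1) 0 0; rewrite scaler0 addr0 scaleN1r addNr.
have TZ a x : T (a *: x) = a *: T x.
  by have := lT a x 0; rewrite T0 !addr0.
have TD x y : T (x + y) = T x + T y.
  by have := lT 1 x y; rewrite !scale1r.
have TN x : T (- x) = - T x by rewrite -scaleN1r TZ scaleN1r.
by split=> // x y; rewrite TD TN.
Qed.

(** The order of a [numFieldType] such as [R[i]] is partial: the failure of [a <= b] yields [b < a]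
    only between reals. *)
Lemma real_le_eps (F : numFieldType) (a b : F) : a \is Num.real -> b \is Num.real ->
  (forall e, 0 < e -> a <= b + e) -> a <= b.
Proof.
move=> ar br ab; rewrite real_leNgt//; apply/negP => ba.
have e0 : 0 < (a - b) / 2 by rewrite divr_gt0// subr_gt0.
have := ab _ e0; rewrite -lerBlDl -subr_le0.
have -> : a - b - (a - b) / 2 = (a - b) / 2 by field.
by move=> /(lt_le_trans e0); rewrite ltxx.
Qed.

Section Operators.
Variables (R : realType) (H : hilbertSpace R).
Implicit Types (x y z : H) (a b : R[i]) (S T : H -> H).
Local Notation "'[ x , y ]" := (hdot H x y).

Lemma sa_form_real T x : adjoint_of T T -> '[T x, x] \is Num.real.
Proof. by move=> aT; apply/CrealP; rewrite [in RHS]aT [RHS]dotC. Qed.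

(** Polarization over the complex scalars: expanding at [x + y] and at [x + 'i *: y] shows that
    ['[T x, y]] is both minus and plus ['[T y, x]]. *)
Lemma form_eq0 T : linear T -> (forall x, '[T x, x] = 0) -> forall x, T x = 0.
Proof.
move=> /linearTP[_ TD _ _ TZ] T0 x; apply: dot_eq0r => y.
have h1 : '[T x, y] + '[T y, x] = 0.
  by have := T0 (x + y); rewrite TD dotDl !dotDr !T0 add0r addr0.
have h2 : '[T y, x] = '[T x, y].
  have := T0 (x + 'i *: y).
  rewrite TD TZ dotDl !dotDr !dotZl !dotZr !T0 conjCi mulr0 mulr0 addr0 add0r.
  rewrite mulNr addrC -mulrBr => /eqP; rewrite mulf_eq0 (negbTE (neq0Ci _))/=.
  by rewrite subr_eq0 => /eqP.
by move: h1; rewrite h2 -mulr2n => /eqP; rewrite mulrn_eq0/= => /eqP.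
Qed.

Lemma op_le_anti S T : linear S -> linear T -> op_le S T -> op_le T S -> S = T.
Proof.
move=> lS lT ST TS; apply/funext => x; apply/subr0_eq; move: x.
apply: (@form_eq0 (fun x => S x - T x)) => [a x y|x].
  by rewrite lS lT scalerBr opprD addrACA.
by rewrite dotBl; apply/subr0_eq/eqP; rewrite subr0 subr_eq0 eq_le ST TS.
Qed.

Lemma op_le_refl T : op_le T T.
Proof. by move=> x. Qed.

Lemma op_le_trans T S U : op_le S T -> op_le T U -> op_le S U.
Proof. by move=> ST TU x; exact: le_trans (ST x) (TU x). Qed.

Lemma form_le_norm T (C : R[i]) x : (forall x, `|T x| <= C * `|x|) ->
  '[T x, x] \is Num.real -> '[T x, x] <= C * '[x, x].
Proof.
move=> TC Tr; apply: le_trans (real_ler_norm Tr) _.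
apply: le_trans (Cauchy_Schwarz _ _) _.
by rewrite -hnormE expr2 mulrA ler_wpM2r.
Qed.

(* Evaluate the form at [x - C^-1 T x]. *)
Lemma pos_norm_le T (C : R[i]) : linear T -> adjoint_of T T -> 0 < C ->
  (forall x, 0 <= '[T x, x]) -> (forall x, '[T x, x] <= C * '[x, x]) ->
  forall x, '[T x, T x] <= C * '[T x, x].
Proof.
move=> /linearTP[_ _ TB _ TZ] aT C0 T0 TC x.
have cC : Num.conj C^-1 = C^-1 by apply/CrealP; rewrite realV gtr0_real.
have := T0 (x - C^-1 *: T x).
rewrite TB TZ dotBl !dotBr !dotZl !dotZr cC (aT (T x) x).
have h := TC (T x) => h2.
have : 0 <= '[T x, x] - C^-1 * '[T x, T x].
  apply: le_trans h2 _; rewrite gerBl -mulrBr.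
  apply: mulr_ge0; first by rewrite invr_ge0 ltW.
  by rewrite subr_ge0 ler_pdivrMl.
by rewrite subr_ge0 ler_pdivrMl.
Qed.

End Operators.

(** * Strong limits of directed families *)

Section VonNeumann.
Variables (R : realType) (H : hilbertSpace R) (M : set (H -> H)).
Hypothesis vM : von_neumann_algebra M.
Implicit Types (x y z : H) (a b c : R[i]) (S T U : H -> H) (D : set (H -> H)).
Local Notation "'[ x , y ]" := (hdot H x y).

Lemma vna_lin T : M T -> linear T.
Proof. by case/(vna_bounded vM). Qed.

Lemma vna0 : M (fun=> 0).
Proof.
rewrite (_ : (fun=> 0) = fun x : H => (-1) *: idfun x + idfun x).
  by apply: (vna_linear vM); exact: vna_id.
by apply/funext => x /=; rewrite scaleN1r addNr.
Qed.

Lemma vnaD S T : M S -> M T -> M (S \+ T).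
Proof.
move=> MS MT; rewrite (_ : S \+ T = fun x => 1 *: S x + T x).
  exact: (vna_linear vM).
by apply/funext => x /=; rewrite scale1r.
Qed.

Lemma vnaN T : M T -> M (\- T).
Proof.
move=> MT; rewrite (_ : \- T = fun x => (-1) *: T x + (fun=> 0) x).
  by apply: (vna_linear vM) => //; exact: vna0.
by apply/funext => x /=; rewrite scaleN1r addr0.
Qed.

Lemma vnaB S T : M S -> M T -> M (S \- T).
Proof. by move=> MS MT; apply: (vnaD MS (vnaN MT)). Qed.

(** The forms at [x] are real and bounded above by that of [U]; [S0] comes within [e] of their
    supremum, taken in [R] through real parts. *)
Lemma bounded_form_increment D U : D `<=` sa_part M -> D !=set0 ->
  (forall S, D S -> op_le S U) -> forall x (e : R[i]), 0 < e -> exists2 S0, D S0 &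
    forall S, D S -> op_le S0 S -> '[S x, x] - '[S0 x, x] <= e.
Proof.
move=> DM [S1 DS1] DU x e e0.
have Sr S : D S -> '[S x, x] = (complex.Re '[S x, x])%:C.
  by move=> /DM[_ [_ aS]]; rewrite RRe_real//; exact: sa_form_real.
pose X := [set complex.Re '[S x, x] | S in D].
have er : e = (complex.Re e)%:C by rewrite RRe_real// gtr0_real.
have e0' : 0 < complex.Re e by move: e0; rewrite er ltcR.
have supX : has_sup X.
  split; first by exists (complex.Re '[S1 x, x]), S1.
  exists (complex.Re '[U x, x]) => _ [S DS <-].
  by have := DU _ DS x; rewrite lecE => /andP[].
have [_ [S0 DS0 <-] S0X] := sup_adherent e0' supX.
exists S0 => // S DS _; rewrite (Sr _ DS) (Sr _ DS0) er -rmorphB/= lecR.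
have : complex.Re '[S x, x] <= sup X by apply: sup_upper_bound => //; exists S.
by move: S0X; lra.
Qed.

(** Beyond [S1] an increment [T - S] is positive and dominated in form by [U - S1], whence a
    constant independent of [S] and [T]; [pos_norm_le] then turns smallness of forms into smallness
    of norms. *)
Lemma directed_increment_bound D U : D `<=` sa_part M -> directed D -> bounded_op U ->
  (forall S, D S -> op_le S U) ->
  exists2 C : R[i], 0 < C & exists2 S1, D S1 & forall S T, D S -> D T -> op_le S1 S ->
    op_le S T -> forall x, `|T x - S x| ^+ 2 <= C * ('[T x, x] - '[S x, x]) /\
    `|T x - S x| <= C * `|x|.
Proof.
move=> DM dD bU DU; have [[S1 DS1] _] := dD.
have [CU CU0 UC] := bounded_opP bU.
have [C1 C10 SC] := bounded_opP (vna_bounded vM (DM _ DS1).1).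
exists (CU + C1); first exact: addr_gt0.
exists S1 => // S T DS DT S1S ST x.
have [[MS [bS aS]] [MT [bT aT]]] := (DM _ DS, DM _ DT).
have [lS lT] := (vna_lin MS, vna_lin MT).
have formB y : '[T y, y] - '[S y, y] <= (CU + C1) * '[y, y].
  apply: (@le_trans _ _ ('[U y, y] - '[S1 y, y])).
    by rewrite lerB// ?DU//; exact: S1S.
  rewrite -dotBl; apply: (@form_le_norm _ _ (U \- S1)) => [z|/=].
    by rewrite /= mulrDl (le_trans (ler_normB _ _))// lerD.
  by rewrite dotBl ger0_real// subr_ge0; exact: DU.
have C0 : 0 < CU + C1 by exact: addr_gt0.
have main : `|T x - S x| ^+ 2 <= (CU + C1) * ('[T x, x] - '[S x, x]).
  rewrite hnormE -!dotBl.
  apply: (@pos_norm_le _ _ (T \- S)) => [|||y|y]//=.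
  - by move=> a y z /=; rewrite lS lT scalerBr opprD addrACA.
  - by move=> y z /=; rewrite dotBl dotBr aS aT.
  - by rewrite dotBl subr_ge0; exact: ST.
  - by rewrite dotBl formB.
split=> //; rewrite -(@ler_pXn2r _ 2)// ?nnegrE//; last first.
  by apply: mulr_ge0 => //; exact: ltW.
apply: le_trans main _; rewrite exprMn hnormE expr2 -mulrA.
by apply: ler_wpM2l => //; exact: ltW.
Qed.

(** Strong operator convergence of [D], regarded as a net indexed by itself. *)
Definition strong_limit D T := forall x (e : R[i]), 0 < e -> exists2 S0, D S0 &
    forall S, D S -> op_le S0 S -> `|T x - S x| < e.

(** An operator [X] of the commutant commutes with each [S] in [D], hence with [T] in the limit, and
    the bicommutant property puts [T] in [M]. Self-adjointness passes to the limit likewise. *)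
Lemma strong_limit_vna D T : D `<=` sa_part M -> directed D -> bounded_op T ->
  strong_limit D T -> sa_part M T.
Proof.
move=> DM [_ dD] bT lD.
(* Directedness gives one member of [D] close to [T] at two vectors at once. *)
have app2 x y (e : R[i]) : 0 < e -> exists2 S, D S & `|T x - S x| < e /\ `|T y - S y| < e.
  move=> e0; have [S1 DS1 h1] := lD x _ e0; have [S2 DS2 h2] := lD y _ e0.
  by have [S [DS S1S S2S]] := dD _ _ DS1 DS2; exists S => //; split; auto.
have eps0 (z C : R[i]) : 0 < C -> (forall e : R[i], 0 < e -> `|z| <= e * C) -> z = 0.
  move=> C0 h; apply/eqP; rewrite -normr_le0; apply: real_le_eps => // e e0.
  by rewrite add0r -(divfK (lt0r_neq0 C0) e) h// divr_gt0.
split.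
  rewrite -(vna_bicommutant vM); split=> // X [bX XM].
  have [CX CX0 XC] := bounded_opP bX.
  apply/funext => x /=; apply/subr0_eq/normr0_eq0.
  apply: (eps0 _ (1 + CX)); first by rewrite addr_gt0.
  move=> e e0; have [S DS [h1 h2]] := app2 x (X x) e e0.
  have SX : S (X x) = X (S x) by have /(congr1 (@^~ x)) := XM _ (DM _ DS).1.
  rewrite normr_id.
  have [_ _ XB _ _] := linearTP bX.1.
  have -> : T (X x) - X (T x) = (T (X x) - S (X x)) - X (T x - S x).
    by rewrite XB SX opprB addrA subrK.
  rewrite (le_trans (ler_normB _ _))// mulrDr mulr1 lerD ?(ltW h2)//.
  by rewrite (le_trans (XC _))// mulrC ler_wpM2r ?(ltW h1) ?(ltW CX0).
split=> // x y; apply/subr0_eq.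
apply: (eps0 _ (1 + `|y| + `|x|)); first by rewrite -addrA ltr_pwDl// addr_ge0.
move=> e e0; have [S DS [h1 h2]] := app2 x y e e0.
have [_ [_ aS]] := DM _ DS.
have -> : '[T x, y] - '[x, T y] = '[T x - S x, y] - '[x, T y - S y].
  by rewrite dotBl dotBr aS opprB addrA subrK.
rewrite (le_trans (ler_normB _ _))// !mulrDr mulr1 -addrA ler_wpDl ?(ltW e0)//.
rewrite lerD// (le_trans (Cauchy_Schwarz _ _))//.
  by rewrite ler_wpM2r// ltW.
by rewrite mulrC ler_wpM2r// ltW.
Qed.

(** Vigier's theorem: at each vector the forms increase to a finite supremum, so
    [directed_increment_bound] makes [D] Cauchy there, and completeness of [H] supplies the
    limit. *)
Lemma vigier D U : D `<=` sa_part M -> directed D -> bounded_op U ->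
  (forall S, D S -> op_le S U) ->
  exists2 T, sa_part M T & strong_limit D T.
Proof.
move=> DM dD bU DU.
have [C C0 [S1 DS1 SC]] := directed_increment_bound DM dD bU DU.
have [[_ _] dDD] := dD.
pose F : set_system (H -> H) := [set A | exists2 S0, D S0 &
  forall S, D S -> op_le S0 S -> A S].
have FF : ProperFilter F.
  split.
    by case=> S0 DS0 /(_ S0 DS0 (@op_le_refl _ _ _)).
  split=> [|A B [S0 DS0 A0] [S2 DS2 B2]|A B AB [S0 DS0 A0]].
  - by exists S1.
  - have [S [DS S0S S2S]] := dDD _ _ DS0 DS2; exists S => // X DX SX; split.
      by apply: A0 => //; exact: op_le_trans SX.
    by apply: B2 => //; exact: op_le_trans SX.
  - by exists S0 => // S DS S0S; apply: AB; exact: A0.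
have FD : F D by exists S1.
have cF x : cvg ((fun S => S x) @ F).
  apply/cauchy_cvgP/cauchy_exP => e e0.
  (* Multiplied by [C], this bound on forms yields a squared norm of at most [(e / 2) ^+ 2]; halving
     [e] makes the final inequality strict. *)
  have eC : 0 < (e / 2) ^+ 2 / C by rewrite divr_gt0// exprn_gt0// divr_gt0.
  have [S0 DS0 h0] := bounded_form_increment DM dD.1 DU x eC.
  have [S2 [DS2 S02 S12]] := dDD _ _ DS0 DS1.
  exists (S2 x); exists S2 => // S DS S2S.
  rewrite -ball_normE /ball_/= distrC.
  apply: (@le_lt_trans _ _ (e / 2)); last by rewrite ltr_pdivrMr// ltr_pMr// ltr1n.
  rewrite -(@ler_pXn2r _ 2)// ?nnegrE// ?divr_ge0 ?(ltW e0)//.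
  apply: le_trans (SC _ _ DS2 DS S12 S2S x).1 _.
  rewrite mulrC -ler_pdivlMr//; apply: le_trans (h0 _ DS (op_le_trans S02 S2S)).
  by rewrite lerD2l lerN2; exact: S02.
pose T x := lim ((fun S => S x) @ F).
have TF x : (fun S => S x) @ F --> T x by exact: cF.
have sT : strong_limit D T.
  move=> x e e0; have /cvgrPdist_lt/(_ _ e0) [S0 DS0 h0] := TF x.
  by exists S0.
have lT : linear T.
  move=> a x y.
  have h : (fun S => S (a *: x + y)) @ F --> a *: T x + T y.
    have : (fun S => a *: S x + S y) @ F --> a *: T x + T y.
      by apply: cvgD; [apply: cvgZr|]; exact: TF.
    apply: cvg_trans; apply: near_eq_cvg; apply: filterS FD => S DS.
    by rewrite (vna_lin (DM _ DS).1).
  exact: (cvg_unique (@norm_hausdorff _ _) (TF _) h).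
exists T => //; apply: (strong_limit_vna DM dD _ sT); split; first exact: lT.
have [C1 C10 S1C] := bounded_opP (vna_bounded vM (DM _ DS1).1).
(* For nonzero [x], the summand 1 pays for [T - S], the error at [x] being taken below the norm of
   [x]; [C] pays for [S - S1] and [C1] for [S1]. *)
exists (1 + C + C1) => x; have [->|x0] := eqVneq x 0.
  have [T0 _ _ _ _] := linearTP lT.
  by rewrite T0 !normr0 mulr0.
have nx0 : 0 < `|x| by rewrite normr_gt0.
have [S0 DS0 h0] := sT x _ nx0.
have [S [DS S0S S1S]] := dDD _ _ DS0 DS1.
have -> : T x = (T x - S x) + (S x - S1 x) + S1 x by rewrite addrA !subrK.
rewrite (le_trans (ler_normD _ _))// mulrDl lerD//.
rewrite (le_trans (ler_normD _ _))// mulrDl lerD//.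
  by rewrite mul1r ltW//; exact: h0.
exact: (SC _ _ DS1 DS _ S1S _).2.
Qed.

End VonNeumann.

(** * Strong limits and least upper bounds *)

Section StrongLimits.
Variables (R : realType) (H : hilbertSpace R) (M : set (H -> H)).
Hypothesis vM : von_neumann_algebra M.
Implicit Types (x y z : H) (a b c : R[i]) (S T U : H -> H) (D : set (H -> H)).
Local Notation "'[ x , y ]" := (hdot H x y).

Section Limit.
Variables (D : set (H -> H)) (T : H -> H).
Hypotheses (DM : D `<=` sa_part M) (dD : directed D).
Hypotheses (MT : sa_part M T) (DT : strong_limit D T).

Lemma strong_limit_form x (e : R[i]) : 0 < e -> exists2 S0, D S0 &
  forall S, D S -> op_le S0 S -> `|'[T x, x] - '[S x, x]| <= e.
Proof.
move=> e0; have x0 : 0 < `|x| + 1 by rewrite ltr_wpDl.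
have [|S0 DS0 h0] := @DT x (e / (`|x| + 1)); first by rewrite divr_gt0.
exists S0 => // S DS S0S; rewrite -dotBl (le_trans (Cauchy_Schwarz _ _))//.
apply: (@le_trans _ _ (e / (`|x| + 1) * (`|x| + 1))).
  by rewrite ler_pM ?(ltW (h0 _ _ _))// lerDl.
by rewrite divfK// gt_eqF.
Qed.

Lemma strong_limit_form_le x c : (forall S, D S -> '[S x, x] <= c) -> '[T x, x] <= c.
Proof.
move=> Dc; have [[S1 DS1] _] := dD.
have rS S : D S -> '[S x, x] \is Num.real.
  by move=> /DM[_ [_ aS]]; exact: sa_form_real.
have rT : '[T x, x] \is Num.real by apply: sa_form_real; case: MT => _ [].
apply: real_le_eps => // [|e e0].
  by rewrite -(ler_real (Dc _ DS1)); exact: rS.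
have [S0 DS0 /(_ _ DS0 (@op_le_refl _ _ _)) h] := strong_limit_form x e0.
rewrite -lerBlDl; apply: le_trans (h); apply: le_trans (real_ler_norm _).
  by rewrite lerB// Dc.
by rewrite realB// rS.
Qed.

Lemma strong_limit_ub S : D S -> op_le S T.
Proof.
move=> DS x; have [_ dDD] := dD.
have rS S' : D S' -> '[S' x, x] \is Num.real.
  by move=> /DM[_ [_ aS]]; exact: sa_form_real.
have rT : '[T x, x] \is Num.real by apply: sa_form_real; case: MT => _ [].
apply: real_le_eps => //; first exact: rS.
move=> e e0; have [S0 DS0 h] := strong_limit_form x e0.
have [S2 [DS2 SS2 S02]] := dDD _ _ DS DS0.
rewrite -lerBlDl; apply: le_trans (h S2 DS2 S02); rewrite distrC.
apply: le_trans (real_ler_norm _); first by rewrite lerD2r; exact: SS2.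
by rewrite realB// rS.
Qed.

Lemma strong_limit_lub : op_lub M D T.
Proof.
split=> //; first exact: strong_limit_ub.
move=> U _ DU x; apply: strong_limit_form_le => S DS; exact: DU.
Qed.
End Limit.

(** Vigier's limit is a least upper bound too, and by antisymmetry there is only one. *)
Lemma op_lub_strong_limit D T : D `<=` sa_part M -> directed D ->
  op_lub M D T -> strong_limit D T.
Proof.
move=> DM dD [MT DT Tmin].
have [T' MT' DT'] := vigier vM DM dD MT.2.1 DT.
suff -> : T = T' by [].
have [_ T'ub T'min] := strong_limit_lub DM dD MT' DT'.
apply: op_le_anti; [exact: (vna_lin vM MT.1)|exact: (vna_lin vM MT'.1)| |].
  exact: Tmin.
exact: T'min.
Qed.

(** [op_lub] tests upper bounds at all vectors together; as a strong limit, the least upper bound is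
    least at each single vector, whatever the ambient algebra. *)
Lemma op_lub_form_le D T x c : D `<=` sa_part M -> directed D -> op_lub M D T ->
  (forall S, D S -> '[S x, x] <= c) -> '[T x, x] <= c.
Proof.
move=> DM dD lT; apply: (strong_limit_form_le DM dD).
  by case: lT.
exact: op_lub_strong_limit.
Qed.

(** * Powers of a positive contraction *)

Section Powers.
Variable A : H -> H.
Hypotheses (MA : M A) (aA : adjoint_of A A).
Hypotheses (A_ge0 : op_le (fun=> 0) A) (A_le1 : op_le A idfun).

Lemma pow_vna k : M (iter k A).
Proof.
elim: k => [|k IH]; first exact: vna_id.
exact: (vna_comp vM MA IH).
Qed.

Lemma pow_adjoint k : adjoint_of (iter k A) (iter k A).
Proof.
by elim: k => [|k IH] x y//; rewrite iterS aA IH -iterSr.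
Qed.

Lemma pow_formD m k x : '[iter (m + k) A x, x] = '[iter k A x, iter m A x].
Proof. by rewrite iterD pow_adjoint. Qed.

(** By parity: the form of [A ^ (2m)] at [x] is the squared norm of [A ^ m x], and that of
    [A ^ (2m+1)] is the form of [A] at [A ^ m x]. *)
Lemma pow_form_ge0 k x : 0 <= '[iter k A x, x].
Proof.
rewrite -(odd_double_half k) -addnn; case: (odd k); last first.
  by rewrite add0n pow_formD dot_ge0.
rewrite add1n -addnS pow_formD iterS.
by have := A_ge0 (iter k./2 A x); rewrite dot0l.
Qed.

Lemma A_normle x : '[A x, A x] <= '[A x, x].
Proof.
rewrite -[leRHS]mul1r; apply: pos_norm_le => // [|y|y].
- exact: (vna_lin vM MA).
- by have := A_ge0 y; rewrite dot0l.
- by rewrite mul1r; exact: A_le1.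
Qed.

(** The same parity split: even [k] uses [A <= 1], odd [k] uses [A ^ 2 <= A], which is
    [A_normle]. *)
Lemma pow_form_anti k x : '[iter k.+1 A x, x] <= '[iter k A x, x].
Proof.
rewrite -(odd_double_half k) -addnn; set m := k./2; case: (odd k); last first.
  by rewrite add0n -addnS !pow_formD iterS; exact: A_le1.
rewrite add1n -addnS -addSn !pow_formD iterS; exact: A_normle.
Qed.

Lemma pow_form_le m k x : (m <= k)%N -> '[iter k A x, x] <= '[iter m A x, x].
Proof.
move=> /subnK <-; elim: (k - m)%N => // n IH.
by rewrite addSn; apply: le_trans (pow_form_anti _ _) IH.
Qed.

(** Negated, since the powers decrease while [directed] and [op_lub] concern increasing families. *)
Definition neg_powers : set (H -> H) := [set \- (iter k A) | k in setT].

Lemma neg_powers_sa : neg_powers `<=` sa_part M.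
Proof.
move=> _ [k _ <-]; split; first exact: (vnaN vM (pow_vna k)).
split; first exact: (vna_bounded vM (vnaN vM (pow_vna k))).
by move=> x y /=; rewrite dotNl dotNr pow_adjoint.
Qed.

Lemma neg_powers_le m k : (m <= k)%N -> op_le (\- (iter m A)) (\- (iter k A)).
Proof. by move=> mk x /=; rewrite !dotNl lerN2 pow_form_le. Qed.

Lemma neg_powers_directed : directed neg_powers.
Proof.
split; first by exists (\- (iter 0 A)), 0%N.
move=> _ _ [m _ <-] [k _ <-]; exists (\- (iter (maxn m k) A)); split.
- by exists (maxn m k).
- by apply: neg_powers_le; rewrite leq_maxl.
- by apply: neg_powers_le; rewrite leq_maxr.
Qed.

(** The powers decrease strongly to [E]. Continuity gives [A E = E], and vectors fixed by [A] are
    fixed by [E], so [E] is idempotent with the same fixed vectors as [A]. *)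
Lemma power_limit : exists E, [/\ M E, projection E,
  forall x, E x = x <-> A x = x & op_lub M neg_powers (\- E)].
Proof.
have [||T MT DT] := @vigier _ _ _ vM neg_powers (fun=> 0) neg_powers_sa neg_powers_directed.
- exact: (vna_bounded vM (vna0 vM)).
- by move=> _ [k _ <-] x /=; rewrite dot0l dotNl oppr_le0 pow_form_ge0.
have lim x (e : R[i]) : 0 < e -> exists k0, forall k, (k0 <= k)%N -> `|- T x - iter k A x| < e.
  move=> e0; have [_ [k0 _ <-] h] := DT x e e0; exists k0 => k k0k.
  have /= := h _ (ex_intro2 _ _ k I erefl) (neg_powers_le k0k).
  by rewrite opprK -normrN opprD.
have lA := vna_lin vM MA; have [A0 AD AB AN AZ] := linearTP lA.
have [C C0 AC] := bounded_opP (vna_bounded vM MA).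
(* Here [- T x] is the limit of the powers at [x]; the defect is [A] applied to the error at [k0],
   minus the error at [k0 + 1]. *)
have AE x : A (- T x) = - T x.
  apply/subr0_eq/normr0_eq0/eqP; rewrite -normr_le0 normr_id; apply: real_le_eps => // e e0.
  have [|k0 h] := lim x (e / (C + 1)); first by rewrite divr_gt0// addr_gt0.
  have -> : A (- T x) - - T x = A (- T x - iter k0 A x) - (- T x - iter k0.+1 A x).
    by rewrite AB iterS opprB addrA subrK.
  have -> : 0 + e = C * (e / (C + 1)) + e / (C + 1) by field; rewrite gt_eqF ?addr_gt0.
  rewrite (le_trans (ler_normB _ _))// lerD//; last by rewrite ltW// h.
  by rewrite (le_trans (AC _))// ler_wpM2l ?(ltW C0)// ltW// h.
have EA x : A x = x -> - T x = x.
  move=> Ax; have Akx k : iter k A x = x by elim: k => //= k ->.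
  apply/subr0_eq/normr0_eq0/eqP; rewrite -normr_le0 normr_id; apply: real_le_eps => // e e0.
  have [k0 /(_ k0 (leqnn _))] := lim x e e0.
  by rewrite Akx add0r => /ltW.
exists (\- T); split.
- exact: (vnaN vM MT.1).
- split; last by apply/funext => x /=; exact: EA.
  split; first exact: (vna_bounded vM (vnaN vM MT.1)).
  by move=> x y /=; rewrite dotNl dotNr MT.2.2.
- by move=> x /=; split=> [<-|]; [exact: AE|exact: EA].
rewrite (_ : \- \- T = T); last by apply/funext => x /=; rewrite opprK.
exact: strong_limit_lub neg_powers_sa neg_powers_directed MT DT.
Qed.

End Powers.
End StrongLimits.

(** * Projections and their meets *)

Section Projections.
Variables (R : realType) (H : hilbertSpace R).
Implicit Types (x y z : H) (P Q : H -> H).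
Local Notation "'[ x , y ]" := (hdot H x y).

Lemma proj_lin P : projection P -> linear P.
Proof. by case=> [[[]]]. Qed.

Lemma proj_adj P : projection P -> adjoint_of P P.
Proof. by case=> [[]]. Qed.

Lemma proj_idem P : projection P -> forall x, P (P x) = P x.
Proof. by case=> _ PP x; rewrite -[in RHS]PP. Qed.

Lemma proj_dot P : projection P -> forall x, '[P x, x] = '[P x, P x].
Proof. by move=> pP x; rewrite -[in LHS](proj_idem pP) (proj_adj pP). Qed.

Lemma proj_ge0 P : projection P -> op_le (fun=> 0) P.
Proof. by move=> pP x; rewrite dot0l (proj_dot pP) dot_ge0. Qed.

Lemma proj_dot_compl P : projection P -> forall x,
  '[x - P x, x - P x] = '[x, x] - '[P x, x].
Proof.
by move=> pP x; rewrite dotBl !dotBr -(proj_dot pP) -(proj_adj pP) subrr subr0.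
Qed.

Lemma proj_le1 P : projection P -> op_le P idfun.
Proof. by move=> pP x; rewrite -subr_ge0 /= -proj_dot_compl// dot_ge0. Qed.

Lemma proj_dot_fix P x : projection P -> '[x, x] <= '[P x, x] -> P x = x.
Proof.
move=> pP h; apply/esym/subr0_eq/dot_eq0/eqP.
by rewrite eq_le dot_ge0 andbT proj_dot_compl// subr_le0.
Qed.

Lemma proj_rangeE P : projection P -> range P = [set x | P x = x].
Proof.
move=> pP; apply/seteqP; split=> x /=; first by case=> y _ <-; exact: proj_idem.
by move=> <-; exists x.
Qed.

Lemma proj_le_fix P Q : projection P -> projection Q -> op_le P Q ->
  forall x, P x = x -> Q x = x.
Proof.
by move=> pP pQ PQ x Px; apply: proj_dot_fix => //; rewrite -{1}Px; exact: PQ.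
Qed.

(** [P Q = P] is the adjoint of [Q P = P]. *)
Lemma proj_fix_absorb P Q : projection P -> projection Q ->
  (forall x, P x = x -> Q x = x) -> (forall x, Q (P x) = P x) /\ (forall x, P (Q x) = P x).
Proof.
move=> pP pQ PQ; have QP x : Q (P x) = P x by apply: PQ; exact: proj_idem.
split=> // x; apply/subr0_eq/dot_eq0r => y.
by rewrite dotBl (proj_adj pP) (proj_adj pQ) QP (proj_adj pP) subrr.
Qed.

Lemma proj_fix_le P Q : projection P -> projection Q ->
  (forall x, P x = x -> Q x = x) -> op_le P Q.
Proof.
move=> pP pQ /(proj_fix_absorb pP pQ)[_ PQ] x.
rewrite (proj_dot pP) -PQ -(proj_dot pP) (proj_dot pQ); exact: proj_le1.
Qed.

Lemma proj_fix_inj P Q : projection P -> projection Q ->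
  (forall x, P x = x <-> Q x = x) -> P = Q.
Proof.
move=> pP pQ PQ; apply: op_le_anti; [exact: proj_lin|exact: proj_lin| |].
  by apply: proj_fix_le => // x /PQ.
by apply: proj_fix_le => // x /PQ.
Qed.

Lemma proj_compl P : projection P -> projection (fun x => x - P x).
Proof.
move=> pP; have lP := proj_lin pP; have [P0 PD PB PN PZ] := linearTP lP.
have [[[_ [C PC]] aP] _] := pP.
split; last by apply/funext => x /=; rewrite PB proj_idem// subrr subr0.
split; last by move=> x y; rewrite dotBl dotBr aP.
split; first by move=> a x y /=; rewrite lP scalerBr opprD addrACA.
exists (1 + C) => x; rewrite mulrDl mul1r (le_trans (ler_normB _ _))//.
by rewrite lerD2l.
Qed.

Lemma compl_fixE P x : projection P -> x - P x = x <-> P x = 0.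
Proof.
move=> pP; split=> [/eqP|->]; last by rewrite subr0.
by rewrite subr_eq addrC -subr_eq subrr eq_sym => /eqP.
Qed.

Section Meet.
Variables (M : set (H -> H)) (P Q : H -> H).
Hypotheses (vM : von_neumann_algebra M).
Hypotheses (MP : M P) (MQ : M Q) (pP : projection P) (pQ : projection Q).

Let A := P \o Q \o P.

Lemma sandwich_vna : M A.
Proof. exact: (vna_comp vM (vna_comp vM MP MQ) MP). Qed.

Lemma sandwich_adj : adjoint_of A A.
Proof. by move=> x y; rewrite /A /= (proj_adj pP) (proj_adj pQ) (proj_adj pP). Qed.

Lemma sandwich_form x : '[A x, x] = '[Q (P x), P x].
Proof. by rewrite /A /= (proj_adj pP). Qed.

Lemma sandwich_ge0 : op_le (fun=> 0) A.
Proof. by move=> x; rewrite dot0l sandwich_form (proj_dot pQ) dot_ge0. Qed.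

Lemma sandwich_leP : op_le A P.
Proof.
by move=> x; rewrite sandwich_form (proj_dot pP); exact: proj_le1.
Qed.

Lemma sandwich_le1 : op_le A idfun.
Proof. by apply: op_le_trans sandwich_leP _; exact: proj_le1. Qed.

(** If [P Q P x = x] then [P x = x], so the form of [Q] at [x] equals ['[x, x]], and [proj_dot_fix]
    applies. *)
Lemma sandwich_fix x : A x = x <-> P x = x /\ Q x = x.
Proof.
split=> [Ax|[Px Qx]]; last by rewrite /A /= Px Qx Px.
have Px : P x = x by rewrite -Ax /A /= proj_idem.
split=> //; apply: proj_dot_fix => //.
by rewrite -{1}Ax sandwich_form Px.
Qed.

(** The limit of the powers of [P Q P] has the common fixed vectors as its range, so the choice made
    in [proj_onto] has a candidate; it is the only one, since ranges determine projections. *)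
Lemma proj_meetP : [/\ M (proj_meet P Q), projection (proj_meet P Q),
  forall x, proj_meet P Q x = x <-> P x = x /\ Q x = x &
  op_lub M (neg_powers A) (\- (proj_meet P Q))].
Proof.
have [E [ME pE fE lE]] := power_limit vM sandwich_vna sandwich_adj sandwich_ge0 sandwich_le1.
suff <- : E = proj_meet P Q.
  by split=> // x; rewrite fE sandwich_fix.
have rE : range E = range P `&` range Q.
  rewrite !proj_rangeE//; apply/seteqP; split=> x /=.
    by move=> /fE/sandwich_fix.
  by move=> PQ; apply/fE/sandwich_fix.
rewrite /proj_meet /proj_onto; case: xgetP => [F _ [pF rF]|/(_ E)[]//].
apply: proj_fix_inj => // x.
have := rE; rewrite -rF !proj_rangeE// => /seteqP[h1 h2].
by split; [exact: h1|exact: h2].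
Qed.

Lemma meet_vna : M (proj_meet P Q). Proof. by have [] := proj_meetP. Qed.
Lemma meet_proj : projection (proj_meet P Q). Proof. by have [] := proj_meetP. Qed.
Lemma meet_fixE x : proj_meet P Q x = x <-> P x = x /\ Q x = x.
Proof. by have [_ _ + _] := proj_meetP. Qed.
End Meet.
End Projections.

(** * The trace of a meet *)

Section Trace.
Variables (R : realType) (H : hilbertSpace R) (M : set (H -> H)) (tau : (H -> H) -> R[i]).
Hypothesis fM : finite_vna M tau.
Let vM : von_neumann_algebra M := fM.1.
Let tM : normal_faithful_tracial_state M tau := fM.2.
Implicit Types (x y z : H) (S T P Q : H -> H).
Local Notation "'[ x , y ]" := (hdot H x y).

Lemma tau0 : tau (fun=> 0) = 0.
Proof.
have := tau_linear tM (-1) (vna0 vM) (vna0 vM).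
rewrite (_ : (fun x : H => (-1) *: (0 : H) + 0) = fun=> 0) ?mulN1r ?addNr//.
by apply/funext => x; rewrite scaler0 addr0.
Qed.

Lemma tauD S T : M S -> M T -> tau (S \+ T) = tau S + tau T.
Proof.
move=> MS MT; rewrite -[tau S]mul1r -(tau_linear tM)//; congr tau.
by apply/funext => x /=; rewrite scale1r.
Qed.

Lemma tauN T : M T -> tau (\- T) = - tau T.
Proof.
move=> MT; apply/eqP; rewrite -addr_eq0 -tauD//; last exact: (vnaN vM).
by apply/eqP; rewrite -tau0; congr tau; apply/funext => x /=; rewrite addNr.
Qed.

Lemma tauB S T : M S -> M T -> tau (S \- T) = tau S - tau T.
Proof. by move=> MS MT; rewrite -tauN// -tauD//; exact: (vnaN vM). Qed.

Lemma tau_le S T : M S -> M T -> op_le S T -> tau S <= tau T.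
Proof.
move=> MS MT ST; rewrite -subr_ge0 -tauB//; apply: (tau_ge0 tM); first exact: (vnaB vM).
by move=> x /=; rewrite dot0l dotBl subr_ge0.
Qed.

Lemma vna_compl P : M P -> M (fun x => x - P x).
Proof. by move=> MP; exact: (vnaB vM (vna_id vM) MP). Qed.

Lemma tau_compl P : M P -> tau (fun x => x - P x) = 1 - tau P.
Proof. by move=> MP; rewrite -(tau_id tM) -tauB//; exact: (vna_id vM). Qed.

(** Faithfulness applied to [Q - P], which is positive of trace zero. *)
Lemma tau_le_eq P Q : M P -> M Q -> projection P -> projection Q ->
  op_le P Q -> tau Q <= tau P -> P = Q.
Proof.
move=> MP MQ pP pQ PQ QP.
have h : Q \- P = fun=> 0.
  apply: (tau_faithful tM (vnaB vM MQ MP)) => [x|].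
    by rewrite /= dot0l dotBl subr_ge0.
  by rewrite tauB//; apply/eqP; rewrite eq_le subr_le0 QP subr_ge0 tau_le.
by apply/funext => x; apply/esym/subr0_eq; exact: (congr1 (@^~ x) h).
Qed.

Section MeetTrace.
Variables P Q : H -> H.
Hypotheses (MP : M P) (MQ : M Q) (pP : projection P) (pQ : projection Q).
Let Pc x := x - P x.
Let Qc x := x - Q x.
Let A := P \o Q \o P.
Let B := Qc \o Pc \o Qc.
Let pPc : projection Pc := proj_compl pP.
Let pQc : projection Qc := proj_compl pQ.
Let MPc : M Pc := vna_compl MP.
Let MQc : M Qc := vna_compl MQ.
Let MA : M A := sandwich_vna vM MP MQ.
Let MB : M B := sandwich_vna vM MQc MPc.

(* With [x = P Qc] and its adjoint [y = Qc P]: [A x = x B], [P - A = x y] and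
   [Qc - B = y x]; the trace property then turns [tau (A^k x y)] into
   [tau (B^k y x)] in [tau_pow_step]. *)
Let intertwine n z : iter n A (P (Qc z)) = P (Qc (iter n B z)).
Proof.
elim: n z => //= n IH z; rewrite IH; move: (iter n B z) => {}z.
have [_ _ PB _ _] := linearTP (proj_lin pP).
have [_ _ QcB _ _] := linearTP (proj_lin pQc).
have Qw := proj_idem pQc z.
rewrite /A /B /= (proj_idem pP); move: (Qc z) Qw => w Qw.
rewrite /Pc (proj_idem pQc) QcB Qw PB /Qc PB (proj_idem pP).
by rewrite opprB addrC subrK.
Qed.

Let tau_pow_step k : tau (iter k.+1 A) - tau (iter k.+2 A) =
  tau (iter k.+1 B) - tau (iter k.+2 B).
Proof.
have MAk n : M (iter n A) := pow_vna vM MA n.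
have MBk n : M (iter n B) := pow_vna vM MB n.
rewrite -!tauB//.
have [_ _ AB _ _] := linearTP (vna_lin vM (MAk k.+1)).
have [_ _ BB _ _] := linearTP (vna_lin vM (MBk k.+1)).
have [_ _ PB _ _] := linearTP (proj_lin pP).
have [_ _ QcB _ _] := linearTP (proj_lin pQc).
have AP z : iter k.+1 A (P z) = iter k.+1 A z.
  by rewrite !iterSr /A /= (proj_idem pP).
have BQ z : iter k.+1 B (Qc z) = iter k.+1 B z.
  by rewrite !iterSr /B /= (proj_idem pQc).
have -> : iter k.+1 A \- iter k.+2 A = (P \o Qc) \o (iter k.+1 B \o P).
  apply/funext => z; rewrite [LHS]/= -/(iter k.+1 A z).
  rewrite -[A (iter k.+1 A z)]/(iter k.+2 A z) [iter k.+2 A z]iterSr -AP -AB.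
  rewrite [RHS]/= -[in RHS]iterS -intertwine; congr (iter k.+1 A _).
  by rewrite /A /Qc /= PB (proj_idem pP).
rewrite (tau_tracial tM); last 2 first.
- exact: (vna_comp vM MP MQc).
- exact: (vna_comp vM (MBk _) MP).
congr tau; apply/funext => z.
rewrite [RHS]/= -/(iter k.+1 B z) -[B (iter k.+1 B z)]/(iter k.+2 B z) [iter k.+2 B z]iterSr.
rewrite -[in RHS]BQ -BB [LHS]/= (proj_idem pP) -/(iter k.+1 B _) -[in LHS]BQ.
by congr (iter k.+1 B _); rewrite /B /= /Pc QcB (proj_idem pQc) opprB addrC subrK.
Qed.

(** The difference of the traces is constant by [tau_pow_step]; at exponent 1 it is
    [tau (P Q) - tau ((1 - P) (1 - Q))], which expands to the stated constant. Exponent 0 is left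
    out, both powers being the identity there. *)
Lemma tau_pow_sandwich k :
  tau (iter k.+1 A) = tau (iter k.+1 B) + (tau P + tau Q - 1).
Proof.
elim: k => [|k IH].
  have -> : tau (iter 1 A) = tau (P \o Q).
    rewrite -[iter 1 A]/((P \o Q) \o P) (tau_tracial tM)//; last exact: (vna_comp vM).
    by congr tau; apply/funext => x /=; rewrite (proj_idem pP).
  have -> : tau (iter 1 B) = tau (Pc \o Qc).
    rewrite -[iter 1 B]/(Qc \o (Pc \o Qc)) (tau_tracial tM)//; last exact: (vna_comp vM).
    by congr tau; apply/funext => x /=; rewrite (proj_idem pQc).
  have [_ _ PB _ _] := linearTP (proj_lin pP).
  have -> : Pc \o Qc = (idfun \- Q) \- (P \- (P \o Q)).
    by apply/funext => x /=; rewrite /Pc /Qc PB.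
  have MPQ := vna_comp vM MP MQ.
  have M1 := vna_id vM.
  rewrite !tauB//; try exact: (vnaB vM).
  rewrite (tau_id tM); ring.
have h := tau_pow_step k.
have -> : tau (iter k.+2 A) = tau (iter k.+1 A) - (tau (iter k.+1 B) - tau (iter k.+2 B)).
  by rewrite -h opprB addrC subrK.
rewrite IH; ring.
Qed.

(** Normality makes [tau] of the meet the infimum of the traces of the powers of [P Q P], so it
    suffices to bound each of these below. *)
Lemma tau_meet_ge : tau P + tau Q - 1 <= tau (proj_meet P Q).
Proof.
have [ME pE _ lE] := proj_meetP vM MP MQ pP pQ.
have aA := sandwich_adj pP pQ; have A0 := sandwich_ge0 pP pQ; have A1 := sandwich_le1 pP pQ.
have [_ min] := tau_normal tM (neg_powers_sa vM MA aA)
  (neg_powers_directed vM MA aA A0 A1) lE.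
rewrite -lerN2 -tauN//; apply: min => _ [_ [k _ <-] <-].
rewrite tauN ?lerN2; last exact: pow_vna.
(* The zeroth power, not covered by [tau_pow_sandwich], has trace 1. *)
case: k => [|k].
  rewrite lerBlDr lerD//.
    by apply: tau_le => //; [exact: (vna_id vM)|exact: proj_le1].
  by rewrite -(tau_id tM) tau_le//; [exact: (vna_id vM)|exact: proj_le1].
rewrite tau_pow_sandwich lerDr; apply: (tau_ge0 tM); first exact: (pow_vna vM MB).
move=> x; rewrite dot0l; apply: pow_form_ge0.
  exact: sandwich_adj.
exact: sandwich_ge0.
Qed.
End MeetTrace.
End Trace.

(** Growth is bounded in the upward direction alone. At the supremum of the points where [f <= c],
    points to its left give [f <= c] and points to its right give [f >= c]. *)
Lemma lipschitz01_IVT (R : realType) (f : R -> R) (c : R) :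
  (forall s t, 0 <= s -> s <= t -> t <= 1 -> f t - f s <= t - s) ->
  f 0 <= c -> c <= f 1 -> exists2 s, 0 <= s <= 1 & f s = c.
Proof.
move=> f_lip f0 f1.
pose X := [set s | 0 <= s <= 1 /\ f s <= c].
have X0 : X 0 by split=> //; rewrite lexx ler01.
have Xub : ubound X 1 by move=> s [/andP[]].
have supX : has_sup X by split; [exists 0|exists 1].
have s0 : 0 <= sup X by exact: sup_upper_bound.
have s1 : sup X <= 1 by apply: ge_sup => //; exists 0.
exists (sup X); first by rewrite s0.
apply/eqP; rewrite eq_le; apply/andP; split.
  apply/ler_addgt0Pr => e e0; have [s [/andP[s_ge0 s_le1] fs] es] := sup_adherent e0 supX.
  have ss : s <= sup X.
    by apply: sup_upper_bound => //; split=> //; rewrite s_ge0.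
  by have := f_lip s (sup X) s_ge0 ss s1; lra.
apply/ler_addgt0Pr => e e0.
have [s1'|s1'] := leP 1 (sup X).
  have -> : sup X = 1 by apply/eqP; rewrite eq_le s1 s1'.
  lra.
(* Capped at 1 to stay in the interval, yet beyond the supremum, so that [f t > c]. *)
set t := Num.min 1 (sup X + e).
have t1 : t <= 1 by rewrite ge_min lexx.
have te : t <= sup X + e by rewrite ge_min lexx orbT.
have st : sup X < t by rewrite lt_min s1' ltrDl.
move: t t1 te st => t t1 te st.
have ft : c < f t.
  rewrite ltNge; apply/negP => ft; have := st; rewrite ltNge => /negP; apply.
  by apply: sup_upper_bound => //; split=> //; rewrite t1 andbT; lra.
have := f_lip (sup X) t s0 (ltW st) t1; lra.
Qed.

(** * Intersecting a flag with a projection *)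

Section Flags.
Variables (R : realType) (H : hilbertSpace R) (M : set (H -> H)) (tau : (H -> H) -> R[i]).
Hypothesis fM : finite_vna M tau.
Let vM : von_neumann_algebra M := fM.1.
Let tM : normal_faithful_tracial_state M tau := fM.2.
Implicit Types (x y z : H) (S T P Q : H -> H) (s t : R).

(** Real-valued, for use in the intermediate value argument; on projections of [M] it carries all of
    [tau], by [tauE]. *)
Definition trace P : R := complex.Re (tau P).

Lemma tauE P : M P -> projection P -> tau P = (trace P)%:C.
Proof.
move=> MP pP; rewrite /trace RRe_real// ger0_real//.
by apply: (tau_ge0 tM) => //; exact: proj_ge0.
Qed.

Lemma trace_le P Q : M P -> M Q -> projection P -> projection Q -> op_le P Q ->
  trace P <= trace Q.
Proof. by move=> MP MQ pP pQ PQ; rewrite -lecR -!tauE//; exact: (tau_le fM). Qed.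

Lemma trace_meet_ge P Q : M P -> M Q -> projection P -> projection Q ->
  trace P + trace Q - 1 <= trace (proj_meet P Q).
Proof.
move=> MP MQ pP pQ; have := tau_meet_ge fM MP MQ pP pQ.
rewrite !tauE//; [|exact: (meet_vna vM)|exact: (meet_proj vM)].
by rewrite -[1]/(1%:C) -rmorphD -rmorphB lecR.
Qed.

Lemma trace_compl P : M P -> trace (fun x => x - P x) = 1 - trace P.
Proof. by move=> MP; rewrite /trace (tau_compl fM)// raddfB. Qed.

Lemma proj_sub P Q : projection P -> projection Q -> op_le P Q -> M P -> M Q ->
  projection (Q \- P).
Proof.
move=> pP pQ PQ MP MQ; have [QP PQ'] := proj_fix_absorb pP pQ (proj_le_fix pP pQ PQ).
split; last first.
  have [_ _ QB _ _] := linearTP (proj_lin pQ); have [_ _ PB _ _] := linearTP (proj_lin pP).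
  by apply/funext => x /=; rewrite QB PB !proj_idem// QP PQ' subrr subr0.
split; first exact: (vna_bounded vM (vnaB vM MQ MP)).
by move=> x y /=; rewrite dotBl dotBr (proj_adj pP) (proj_adj pQ).
Qed.

Section OneFlag.
Variables (e : R -> H -> H) (C : H -> H).
Hypotheses (fe : flag M tau e) (MC : M C) (pC : projection C).

Lemma flag_vna t : 0 <= t <= 1 -> M (e t).
Proof. by case: fe => h _ _ /h[]. Qed.
Lemma flag_proj t : 0 <= t <= 1 -> projection (e t).
Proof. by case: fe => h _ _ /h[]. Qed.
Lemma flag_trace t : 0 <= t <= 1 -> trace (e t) = t.
Proof. by case: fe => _ _ h /h; rewrite /trace => ->. Qed.
Lemma flag_le s t : 0 <= s -> s <= t -> t <= 1 -> op_le (e s) (e t).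
Proof. by case: fe => _ h _; exact: h. Qed.

Lemma flag1 : e 1 = idfun.
Proof.
have h1 : 0 <= (1 : R) <= 1 by rewrite ler01 lexx.
have pid : projection (idfun : H -> H).
  split=> //; split=> //; first exact: (vna_bounded vM (vna_id vM)).
apply: (tau_le_eq fM (flag_vna h1) (vna_id vM) (flag_proj h1) pid).
  exact: proj_le1 (flag_proj h1).
by rewrite (tau_id tM) (tauE (flag_vna h1) (flag_proj h1)) flag_trace.
Qed.

Let F t := proj_meet C (e t).

Lemma meet_flag_vna t : 0 <= t <= 1 -> M (F t).
Proof. by move=> t01; apply: (meet_vna vM) => //; [exact: flag_vna|exact: flag_proj]. Qed.

Lemma meet_flag_proj t : 0 <= t <= 1 -> projection (F t).
Proof. by move=> t01; apply: (meet_proj vM) => //; [exact: flag_vna|exact: flag_proj]. Qed.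

Lemma meet_flag_fix t x : 0 <= t <= 1 -> F t x = x <-> C x = x /\ e t x = x.
Proof. by move=> t01; apply: (meet_fixE vM) => //; [exact: flag_vna|exact: flag_proj]. Qed.

Lemma meet_flag_le s t : 0 <= s -> s <= t -> t <= 1 -> op_le (F s) (F t).
Proof.
move=> s0 st t1.
have s01 : 0 <= s <= 1 by rewrite s0 (le_trans st).
have t01 : 0 <= t <= 1 by rewrite t1 (le_trans s0).
apply: proj_fix_le; [exact: meet_flag_proj|exact: meet_flag_proj|] => x.
move=> /(meet_flag_fix _ s01)[Cx ex]; apply/(meet_flag_fix _ t01); split=> //.
exact: (proj_le_fix (flag_proj s01) (flag_proj t01) (flag_le s0 st t1)).
Qed.

(** Meet [F t] with [G = 1 - (e t - e s)], of trace [1 - (t - s)]: a vector fixed by both is fixed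
    by [e s], so the meet lies below [F s], while its trace is at least [trace (F t) - (t - s)]. *)
Lemma meet_flag_lipschitz s t : 0 <= s -> s <= t -> t <= 1 ->
  trace (F t) - trace (F s) <= t - s.
Proof.
move=> s0 st t1.
have s01 : 0 <= s <= 1 by rewrite s0 (le_trans st).
have t01 : 0 <= t <= 1 by rewrite t1 (le_trans s0).
have [Ms Mt ps pt] := And4 (flag_vna s01) (flag_vna t01) (flag_proj s01) (flag_proj t01).
have pts := proj_sub ps pt (flag_le s0 st t1) Ms Mt.
have Mts := vnaB vM Mt Ms.
pose G x := x - (e t \- e s) x.
have MG : M G := vna_compl fM Mts.
have pG : projection G := proj_compl pts.
have trG : trace G = 1 - (t - s).
  rewrite trace_compl// /trace (tauB fM)// (tauE Ms ps) (tauE Mt pt) -rmorphB/=.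
  by rewrite !flag_trace.
have := trace_meet_ge (meet_flag_vna t01) MG (meet_flag_proj t01) pG.
rewrite trG => h.
suff : trace (proj_meet (F t) G) <= trace (F s) by lra.
have MF := meet_flag_vna t01; have pF := meet_flag_proj t01.
apply: trace_le; [exact: (meet_vna vM)|exact: meet_flag_vna| | |].
- exact: (meet_proj vM).
- exact: meet_flag_proj.
apply: proj_fix_le; [exact: (meet_proj vM)|exact: meet_flag_proj|] => x.
move=> /(meet_fixE vM MF MG pF pG)[/(meet_flag_fix _ t01)[Cx etx]].
move=> /(compl_fixE _ pts)/= /subr0_eq; rewrite etx => esx.
by apply/(meet_flag_fix _ s01).
Qed.

Lemma meet_flag_IVT (c : R) : 0 <= c -> c <= trace C ->
  exists2 s, 0 <= s <= 1 & trace (F s) = c.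
Proof.
move=> c0 cC; apply: (lipschitz01_IVT meet_flag_lipschitz).
  (* At 0 the trace is at most that of [e 0], which is 0; at 1, [F 1 = C] because [e 1] is the
     identity. *)
  have h0 : 0 <= (0 : R) <= 1 by rewrite ler01 lexx.
  apply: le_trans c0; rewrite -[leRHS](flag_trace h0).
  apply: trace_le; [exact: meet_flag_vna|exact: flag_vna|exact: meet_flag_proj|exact: flag_proj|].
  apply: proj_fix_le; [exact: meet_flag_proj|exact: flag_proj|] => x.
  by move=> /(meet_flag_fix _ h0)[].
have h1 : 0 <= (1 : R) <= 1 by rewrite ler01 lexx.
suff -> : F 1 = C by [].
apply: proj_fix_inj => //; first exact: meet_flag_proj.
move=> x; split=> [/(meet_flag_fix _ h1)[]//|Cx].
by apply/(meet_flag_fix _ h1); split=> //; rewrite flag1.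
Qed.

(* If [F s] is not below [F t] then [t < s], and the projections coincide. *)
Lemma meet_flag_trace_le s t : 0 <= s <= 1 -> 0 <= t <= 1 ->
  trace (F s) <= trace (F t) -> op_le (F s) (F t).
Proof.
move=> s01 t01 h; have [/andP[s0 s1] /andP[t0 t1]] := (s01, t01).
have [st|/ltW ts] := leP s t; first exact: meet_flag_le.
have Mt := meet_flag_vna t01; have Ms := meet_flag_vna s01.
have pt := meet_flag_proj t01; have ps := meet_flag_proj s01.
rewrite -(tau_le_eq fM Mt Ms pt ps (meet_flag_le t0 ts s1)) => [x//|].
by rewrite !tauE// lecR.
Qed.
End OneFlag.
End Flags.

(** * Corners of a von Neumann algebra *)

Section Corner.
Variables (R : realType) (H : hilbertSpace R) (q : H -> H).
Hypothesis qP : projection q.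

(** The range of [q] as a set of fixed vectors, so that membership is a boolean equation. The proof
    that [q] is a projection is a parameter, so that the submodule instance can be attached to the
    predicate. *)
Definition fixed_pred of projection q : {pred H} := [pred x | q x == x].

Lemma fixed_pred_submod : submod_closed (fixed_pred qP).
Proof.
have [[[lq _] _] _] := qP.
split=> [|a x y]; rewrite !inE.
  by have := lq (-1) 0 0; rewrite scaler0 addr0 scaleN1r addNr => ->.
by rewrite lq => /eqP-> /eqP->.
Qed.
HB.instance Definition _ := GRing.isSubmodClosed.Build _ _ (fixed_pred qP) fixed_pred_submod.

Record corner := Corner { cval : H; _ : cval \in fixed_pred qP }.
HB.instance Definition _ := [isSub for cval].
HB.instance Definition _ := [Choice of corner by <:].
HB.instance Definition _ := [SubChoice_isSubLmodule of corner by <:].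

Definition cnorm (x : corner) : R[i] := `|val x|.
Lemma cnormD x y : cnorm (x + y) <= cnorm x + cnorm y.
Proof. exact: ler_normD. Qed.
Lemma cnormZ (l : R[i]) x : cnorm (l *: x) = `|l| * cnorm x.
Proof. exact: normrZ. Qed.
Lemma cnorm0_eq0 x : cnorm x = 0 -> x = 0.
Proof. by move=> /normr0_eq0 h; apply: val_inj. Qed.
HB.instance Definition _ := Lmodule_isNormed.Build R[i] corner cnormD cnormZ cnorm0_eq0.

(** The default 0 of [insubd] is never reached, since [q x] is always fixed by [q]. *)
Definition cproj (x : H) : corner := insubd (0 : corner) (q x).
Lemma cprojE x : val (cproj x) = q x.
Proof.
rewrite val_insubd inE; case: qP => _ /(congr1 (@^~ x))/= ->.
by rewrite eqxx.
Qed.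
Lemma cvalP (x : corner) : q (val x) = val x.
Proof. by apply/eqP; exact: (valP x). Qed.
Lemma cprojK x : cproj (val x) = x.
Proof. by apply: val_inj; rewrite cprojE cvalP. Qed.
Lemma cproj_linear : linear cproj.
Proof.
have [[[lq _] _] _] := qP.
by move=> a x y; apply: val_inj; rewrite cprojE lq -!cprojE.
Qed.
(** A Cauchy filter converges in [H] to some [y]; its points being fixed by the bounded [q], it also
    converges to [q y], which lies in the corner. *)
Lemma corner_complete (F : set_system corner) : ProperFilter F -> cauchy F -> cvg F.
Proof.
have [[bq _] _] := qP; have lq := bq.1.
have [C C0 {}bq] := bounded_opP bq.
move=> FF /cauchyP Fc.
have vF : ProperFilter ((val : corner -> H) @ F) by exact: fmap_proper_filter.
have /cauchy_cvg/cvg_ex[y Fy] : cauchy ((val : corner -> H) @ F).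
  apply: cauchy_exP => e e0; have [x Fx] := Fc _ e0; exists (val x).
  by move: Fx; rewrite -!ball_normE.
apply/cvg_ex; exists (cproj y).
apply/cvgrPdist_lt => e e0.
have eC : 0 < e / C by rewrite divr_gt0.
have := Fy; move=> /cvgrPdist_lt /(_ _ eC).
apply: filterS => x xC.
suff -> : `|cproj y - x| = `|q (y - val x)|.
  by rewrite (le_lt_trans (bq _))// mulrC -ltr_pdivlMr.
have -> : y - val x = (-1) *: val x + y by rewrite scaleN1r addrC.
by rewrite lq cvalP scaleN1r addrC -cprojE.
Qed.
HB.instance Definition _ := Uniform_isComplete.Build corner corner_complete.

Definition cdot (x y : corner) := hdot H (val x) (val y).
Lemma cdot_bilinear : bilinear_for ( *%R : GRing.Scale.law _ _)
  (Num.conj \; *%R : GRing.Scale.law _ _) cdot.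
Proof.
split=> [u a x y|u a x y]; rewrite /cdot.
  by rewrite dotDl dotZl.
by rewrite dotDr dotZr.
Qed.
HB.instance Definition _ := bilinear_isBilinear.Build _ _ _ _ _ _ cdot cdot_bilinear.
Lemma cdot_hermitian x y : cdot x y = (-1)^+ false * Num.conj (cdot y x).
Proof. by rewrite expr0 mul1r; exact: dotC. Qed.
HB.instance Definition _ := isHermitianSesquilinear.Build _ _ _ _ cdot cdot_hermitian.
Lemma cdot_gt0 u : u != 0 -> 0 < cdot u u.
Proof. by move=> u0; exact: neq0_dnorm_gt0. Qed.
HB.instance Definition _ := isDotProduct.Build _ _ cdot cdot_gt0.
Lemma cnormE (x : corner) : `|x| ^+ 2 = cdot x x.
Proof. exact: hnormE. Qed.
Definition corner_space : hilbertSpace R := HilbertSpace cnormE.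
Local Notation K := corner_space.
Implicit Types (S T P : K -> K).

(** Extension by zero on the orthogonal complement of the range of [q]; together with [compress] it
    identifies operators on the corner with those of the form [q X q]. *)
Definition corner_ext T : H -> H := fun x => val (T (cproj x)).
Definition compress (X : H -> H) : K -> K := fun x => cproj (X (val x)).

Lemma corner_dotE (x y : K) : hdot K x y = hdot H (val x) (val y).
Proof. by []. Qed.

Lemma corner_ext_compress X x : corner_ext (compress X) x = q (X (q x)).
Proof. by rewrite /corner_ext /compress !cprojE. Qed.

Lemma compressK T : compress (corner_ext T) = T.
Proof. by apply/funext => x; rewrite /compress /corner_ext !cprojK. Qed.

Lemma corner_ext_val T (x : K) : corner_ext T (val x) = val (T x).
Proof. by rewrite /corner_ext cprojK. Qed.

Lemma corner_ext_inj S T : corner_ext S = corner_ext T -> S = T.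
Proof. by move=> ST; rewrite -(compressK S) ST compressK. Qed.

Lemma corner_ext_comp S T : corner_ext (S \o T) = corner_ext S \o corner_ext T.
Proof. by apply/funext => x; rewrite /corner_ext /= cprojK. Qed.

Lemma corner_ext_form S x y : hdot H (corner_ext S x) y = hdot K (S (cproj x)) (cproj y).
Proof.
rewrite corner_dotE cprojE /corner_ext.
by rewrite -(proj_adj qP) cvalP.
Qed.

Lemma corner_ext_formr S x y : hdot H x (corner_ext S y) = hdot K (cproj x) (S (cproj y)).
Proof. by rewrite dotC corner_ext_form -dotC. Qed.

Lemma corner_ext_adjoint S T : adjoint_of (corner_ext S) (corner_ext T) <-> adjoint_of S T.
Proof.
split=> ST x y; last by rewrite corner_ext_form corner_ext_formr ST.
by have := ST (val x) (val y); rewrite corner_ext_form corner_ext_formr !cprojK.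
Qed.

Lemma corner_ext_le S T : op_le (corner_ext S) (corner_ext T) <-> op_le S T.
Proof.
split=> ST x; last by rewrite !corner_ext_form.
by have := ST (val x); rewrite !corner_ext_form cprojK.
Qed.

Lemma corner_ext_ge0 T : op_le (fun=> 0) (corner_ext T) <-> op_le (fun=> 0) T.
Proof. exact: (corner_ext_le (fun=> 0)). Qed.

Lemma corner_ext_bounded T : bounded_op (corner_ext T) <-> bounded_op T.
Proof.
split=> [[lT [C TC]]|[lT [C TC]]]; split.
- move=> a x y; apply: val_inj.
  by have := lT a (val x) (val y); rewrite -[_ + _]/(val (a *: x + y)) !corner_ext_val.
- by exists C => x; have := TC (val x); rewrite corner_ext_val.
- by move=> a x y; rewrite /corner_ext cproj_linear lT.
have [[[lq [Cq qC]] _] _] := qP.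
have [|D D0 TD] := @bounded_opP _ _ T; first by split; last exists C.
exists (D * Cq) => x; apply: le_trans (TD _) _.
rewrite -mulrA ler_wpM2l ?(ltW D0)//.
by have := qC x; rewrite -cprojE.
Qed.

Lemma corner_ext_projection T : projection (corner_ext T) <-> projection T.
Proof.
split=> [[[bT aT] TT]|[[bT aT] TT]].
  split; first by split; [exact/corner_ext_bounded|exact/corner_ext_adjoint].
  by apply: corner_ext_inj; rewrite corner_ext_comp.
split; first by split; [exact/corner_ext_bounded|exact/corner_ext_adjoint].
by rewrite -corner_ext_comp TT.
Qed.

Lemma corner_ext_fix T x : corner_ext T x = x <-> q x = x /\ T (cproj x) = cproj x.
Proof.
split=> [Tx|[qx Tx]]; last by rewrite /corner_ext Tx cprojE.
by split; [rewrite -Tx cvalP|apply: val_inj; rewrite [LHS]Tx cprojE -Tx cvalP].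
Qed.

(** * The corner algebra and its trace *)

Section CornerAlgebra.
Variables (M : set (H -> H)) (tau : (H -> H) -> R[i]).
Hypotheses (fM : finite_vna M tau) (Mq : M q).
Let vM : von_neumann_algebra M := fM.1.
Let tM : normal_faithful_tracial_state M tau := fM.2.

(** Under [corner_ext] this is [q M q]. *)
Definition corner_vna : set (K -> K) := [set T | M (corner_ext T)].
Definition corner_tau T : R[i] := (tau q)^-1 * tau (corner_ext T).
Local Notation N := corner_vna.

Lemma compress_vna X : M X -> N (compress X).
Proof.
move=> MX; rewrite /N /= (_ : corner_ext _ = q \o X \o q).
  exact: (vna_comp vM (vna_comp vM Mq MX) Mq).
by apply/funext => x; rewrite corner_ext_compress.
Qed.

(* For the bicommutant, an operator [X] in [M'] restricts to the corner, the
   restriction lies in [N'], and so [corner_ext T] commutes with [X] for [T] in [N'']. *)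
Lemma corner_vna_von_neumann : von_neumann_algebra N.
Proof.
split.
- by move=> T /(vna_bounded vM)/corner_ext_bounded.
- rewrite /N /= (_ : corner_ext _ = q)//.
  by apply/funext => x; rewrite /corner_ext /= cprojE.
- by move=> a S T NS NT; exact: (vna_linear vM a NS NT).
- by move=> S T NS NT; rewrite /N /= corner_ext_comp; exact: (vna_comp vM).
- move=> T /(vna_adjoint vM)[S MS aS]; exists (compress S); first exact: compress_vna.
  move=> x y; rewrite !corner_dotE cprojE.
  by rewrite -(proj_adj qP) cvalP -aS corner_ext_val.
apply/seteqP; split=> [T [bT TN]|T NT]; last first.
  split; first exact/corner_ext_bounded/(vna_bounded vM).
  by move=> S [_ /(_ T NT)].
rewrite /N /= -(vna_bicommutant vM); split; first exact/corner_ext_bounded.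
move=> X [bX XM]; have Xq x : X (q x) = q (X x) := congr1 (@^~ x) (XM _ Mq).
have NX : commutant N (compress X).
  split.
    apply/corner_ext_bounded; have [lX _] := bX; have [lq _] := qP.1.1.
    have [C C0 XC] := bounded_opP bX; have [Cq Cq0 qC] := bounded_opP qP.1.1.
    split=> [a x y|]; first by rewrite !corner_ext_compress lq lX lq.
    exists (Cq * (C * Cq)) => x; rewrite corner_ext_compress (le_trans (qC _))//.
    rewrite -mulrA ler_wpM2l ?(ltW Cq0)// (le_trans (XC _))//.
    by rewrite -mulrA ler_wpM2l ?(ltW C0).
  move=> S NS; apply/funext => x; apply: val_inj => /=.
  have /(congr1 (@^~ (val x)))/= := XM _ NS.
  rewrite !corner_ext_val /compress cprojE -Xq cvalP => ->.
  by [].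
apply/funext => x /=; have /(congr1 (fun f => val (f (cproj x))))/= := TN _ NX.
rewrite /compress !cprojE -Xq cvalP => <-.
rewrite /corner_ext; congr (val (T _)); apply: val_inj.
by rewrite !cprojE Xq (proj_idem qP).
Qed.

Hypothesis tq0 : tau q != 0.

Let tq_gt0 : 0 < tau q.
Proof. by rewrite lt_def tq0; apply: (tau_ge0 tM) => //; exact: proj_ge0. Qed.

Let itq_gt0 : 0 < (tau q)^-1.
Proof. by rewrite invr_gt0. Qed.

Lemma corner_tau_state : normal_faithful_tracial_state N corner_tau.
Proof.
split.
- move=> a S T NS NT; rewrite /corner_tau mulrCA -mulrDr.
  by congr (_ * _); exact: (tau_linear tM a NS NT).
- move=> T NT T0; rewrite /corner_tau mulr_ge0 ?(ltW itq_gt0)//.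
  by apply: (tau_ge0 tM) => //; apply/corner_ext_ge0.
- rewrite /corner_tau (_ : corner_ext _ = q) ?mulVf//.
  by apply/funext => x; rewrite /corner_ext /= cprojE.
- move=> S T NS NT; rewrite /corner_tau (corner_ext_comp S T) (corner_ext_comp T S); congr (_ * _).
  exact: (tau_tracial tM).
- move=> T NT T0 /eqP; rewrite mulf_eq0 gt_eqF//= => /eqP t0.
  apply: corner_ext_inj; apply: (tau_faithful tM) => //; exact/corner_ext_ge0.
move=> D T DN dD lT.
pose D' := [set corner_ext S | S in D].
have D'M : D' `<=` sa_part M.
  move=> _ [S /DN[NS [bS aS]] <-]; split=> //; split; first exact/corner_ext_bounded.
  exact/corner_ext_adjoint.
have dD' : directed D'.
  have [[S0 DS0] dDD] := dD; split; first by exists (corner_ext S0), S0.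
  move=> _ _ [S DS <-] [S' DS' <-]; have [U [DU SU SU']] := dDD _ _ DS DS'.
  exists (corner_ext U); split; [by exists U|exact/corner_ext_le|exact/corner_ext_le].
have lT' : op_lub M D' (corner_ext T).
  have [[NT [bT aT]] Tub _] := lT; split.
  - split=> //; split; [exact/corner_ext_bounded|exact/corner_ext_adjoint].
  - by move=> _ [S DS <-]; apply/corner_ext_le; exact: Tub.
  (* [U] need not come from the corner, so the minimality of [T] cannot be applied to it; the
     comparison is made at the single vector [cproj x]. *)
  move=> U _ DU x; rewrite corner_ext_form.
  apply: (op_lub_form_le corner_vna_von_neumann DN dD lT) => S DS.
  by rewrite -corner_ext_form; apply: DU; exists S.
have [ub min] := tau_normal tM D'M dD' lT'.
split=> [_ [S DS <-]|z Dz].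
  rewrite /corner_tau ler_wpM2l ?(ltW itq_gt0)//; apply: ub.
  by exists (corner_ext S) => //; exists S.
rewrite /corner_tau mulrC ler_pdivrMr//; apply: min => _ [_ [S DS <-] <-].
by rewrite -ler_pdivrMr// mulrC; apply: Dz; exists S.
Qed.

Lemma corner_finite_vna : finite_vna N corner_tau.
Proof. by split; [exact: corner_vna_von_neumann|exact: corner_tau_state]. Qed.

Lemma compressE X : projection X -> op_le X q -> corner_ext (compress X) = X.
Proof.
move=> pX Xq; have [qX Xq'] := proj_fix_absorb pX qP (proj_le_fix pX qP Xq).
by apply/funext => x; rewrite corner_ext_compress Xq' qX.
Qed.

Lemma corner_ext_leq T : projection T -> op_le (corner_ext T) q.
Proof.
move=> /corner_ext_projection pT; apply: proj_fix_le => // x.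
by move=> /corner_ext_fix[].
Qed.

(** A projection of [M] below [corner_ext P] lies below [q], so it comes from the corner; a minimal
    projection there would stay minimal in [M]. *)
Lemma corner_diffuse : diffuse M -> diffuse N.
Proof.
move=> dM [P [NP pP P0 Pmin]]; apply: dM; exists (corner_ext P); split=> //.
- exact/corner_ext_projection.
- by move=> P0'; apply: P0; apply: corner_ext_inj.
move=> Q MQ pQ QP; have eQ : corner_ext (compress Q) = Q.
  by apply: compressE => //; apply: op_le_trans QP _; exact: corner_ext_leq.
have [||Q0|QP'] := Pmin (compress Q) (compress_vna MQ).
- by apply/corner_ext_projection; rewrite eQ.
- by apply/corner_ext_le; rewrite eQ.
- by left; rewrite -eQ Q0.
- by right; rewrite -eQ QP'.
Qed.

End CornerAlgebra.
End Corner.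

Arguments compress {R H q} qP X _.
Arguments corner_vna {R H q} qP M _.
Arguments corner_tau {R H q} qP tau T.

(** * Index sets *)

Section Subsets.
Variables (n r : nat) (I : rsubset n r).
Local Open Scope nat_scope.

(** [l = 0] is allowed, since [u], [v] and [w] may be 0. *)
Lemma ith_le l : l <= r -> ith I l <= n.
Proof.
have /and3P[/eqP szI _ /allP bnd] := eltsP I.
case: l => [//|l lr]; rewrite /ith /=.
by have /bnd/andP[] : nth 0 I l \in (I : seq nat) by rewrite mem_nth ?szI.
Qed.

Lemma ith_mono l m : l <= m -> m <= r -> ith I l <= ith I m.
Proof.
have /and3P[/eqP szI srt _] := eltsP I.
case: l => [|l]; first by rewrite /ith.
case: m => [//|m] lm mr; rewrite /ith /=.
apply: (sorted_leq_nth leq_trans leqnn) => //; last 2 first.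
- by rewrite inE szI (leq_trans lm).
- by rewrite inE szI.
by move: srt; rewrite ltn_sorted_uniq_leq => /andP[].
Qed.

Lemma ith_raise u l : 1 <= l <= r -> ith (raise u I) l = ith I l + hstep u l.
Proof.
case: l => [//|l] lr; rewrite {1}/ith /= (nth_map 0) ?size_iota//.
by rewrite nth_iota.
Qed.
End Subsets.

(** * Reduction to the corner *)

Section Reduction.
Variables (R : realType) (H : hilbertSpace R) (M : set (H -> H)) (tau : (H -> H) -> R[i]).
Hypothesis fM : finite_vna M tau.
Let vM : von_neumann_algebra M := fM.1.
Implicit Types (a b c i m n : nat).

Lemma ratio01 i n : (i <= n)%N -> (0 < n)%N -> 0 <= (i%:R / n%:R : R) <= 1.
Proof. by move=> ni n0; rewrite divr_ge0//= ler_pdivrMr ?ltr0n// mul1r ler_nat. Qed.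

Lemma complex_ratio i n : (i%:R / n%:R : R)%:C = i%:R / n%:R.
Proof. by rewrite fmorph_div/= !rmorph_nat. Qed.

(** The join is handled through complements: the meet of the three complements has trace at least
    [1 - (a + b + c) / (n + 1)], hence at least [1 / (n + 1)], and [q] is the complement of a
    projection below it of trace exactly [1 / (n + 1)], cut out by a member of [e]. *)
Lemma flag_join_le (e f g : R -> H -> H) n a b c :
  flag M tau e -> flag M tau f -> flag M tau g -> (a + b + c <= n)%N ->
  exists q, [/\ M q, projection q, tau q = n%:R / n.+1%:R &
    [/\ op_le (e (a%:R / n.+1%:R)) q, op_le (f (b%:R / n.+1%:R)) q
      & op_le (g (c%:R / n.+1%:R)) q]].
Proof.
move=> fe ff fg abcn.
have an : (a <= n.+1)%N by lia.
have bn : (b <= n.+1)%N by lia.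
have cn : (c <= n.+1)%N by lia.
have a01 := ratio01 an (ltn0Sn n); have b01 := ratio01 bn (ltn0Sn n).
have c01 := ratio01 cn (ltn0Sn n).
have complP (h : R -> H -> H) t : flag M tau h -> 0 <= t <= 1 ->
    let P := fun x => x - h t x in [/\ M P, projection P & trace tau P = 1 - t].
  move=> fh t01; split; first exact: (vna_compl fM (flag_vna fh t01)).
    exact: proj_compl (flag_proj fh t01).
  by rewrite (trace_compl fM (flag_vna fh t01)) (flag_trace fh t01).
have := complP e _ fe a01; have := complP f _ ff b01; have := complP g _ fg c01.
set C1 := (fun x => x - e _ x); set C2 := (fun x => x - f _ x); set C3 := (fun x => x - g _ x).
move=> /=[M3 p3 t3] [M2 p2 t2] [M1 p1 t1].
have M12 := meet_vna vM M1 M2 p1 p2; have p12 := meet_proj vM M1 M2 p1 p2.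
have MC := meet_vna vM M12 M3 p12 p3; have pC := meet_proj vM M12 M3 p12 p3.
have trC : 1 / n.+1%:R <= trace tau (proj_meet (proj_meet C1 C2) C3).
  have h1 := trace_meet_ge fM M1 M2 p1 p2.
  have h2 := trace_meet_ge fM M12 M3 p12 p3.
  have : 1%:R / n.+1%:R + (a%:R / n.+1%:R + b%:R / n.+1%:R + c%:R / n.+1%:R) <= (1 : R).
    rewrite -!mulrDl ler_pdivrMr ?ltr0n// mul1r -!natrD ler_nat; lia.
  move: h1 h2; rewrite t1 t2 t3.
  move: (a%:R / _) (b%:R / _) (c%:R / _) (1 / _) => ? ? ? ?; lra.
have [|s s01 trs] := meet_flag_IVT fM fe MC pC _ trC; first by rewrite divr_ge0.
have MC' := meet_flag_vna fM fe MC pC s01; have pC' := meet_flag_proj fM fe MC pC s01.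
have fC' := meet_flag_fix fM fe MC pC _ s01.
set C' := proj_meet _ _ in trs MC' pC' fC'.
exists (fun x => x - C' x); split.
- exact: (vna_compl fM).
- exact: proj_compl.
- rewrite (tauE fM (vna_compl fM MC') (proj_compl pC')) (trace_compl fM)// trs.
  have nS0 : (n.+1%:R : R) != 0 by rewrite pnatr_eq0.
  rewrite -complex_ratio; congr (_%:C).
  by rewrite -[X in X - _](divff nS0) -mulrBl -[X in X - 1]natr1 addrK.
(* [C'] lies below the complement of [h t], so it kills the range of [h t]. *)
have under (h : R -> H -> H) t : flag M tau h -> 0 <= t <= 1 ->
    (forall x, C' x = x -> x - h t x = x) -> op_le (h t) (fun x => x - C' x).
  move=> fh t01 C'h; have pc := proj_compl (flag_proj fh t01).
  have [_ absorb] := proj_fix_absorb pC' pc C'h.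
  apply: proj_fix_le; [exact: (flag_proj fh)|exact: proj_compl|] => x hx.
  apply/(compl_fixE _ pC'); rewrite -absorb hx subrr.
  by have [] := linearTP (proj_lin pC').
split; apply: under => // x /fC'[/(meet_fixE vM M12 M3 p12 p3)[/(meet_fixE vM M1 M2 p1 p2)[h1 h2] h3] _].
- exact: h1.
- exact: h2.
- exact: h3.
Qed.

(** * Flags in the corner *)

Section CornerFlag.
Variables (q : H -> H) (qP : projection q) (n : nat).
Hypotheses (Mq : M q) (n0 : (0 < n)%N) (tq : tau q = n%:R / n.+1%:R).
Local Notation N := (corner_vna qP M).
Local Notation tauN := (corner_tau qP tau).

Let trq : trace tau q = n%:R / n.+1%:R.
Proof. by rewrite /trace tq -complex_ratio. Qed.

(** With [F t] the meet of [q] and [e t], [e' t] is an [F s] of trace [t * n / (n + 1)]. The [F] are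
    compared through their traces: that of [F ((i+1)/(n+1))] is at least
    [n/(n+1) + (i+1)/(n+1) - 1 = i/(n+1)], and if [i <= m] then [e (i/(n+1))] already lies below
    [q], so no trace is lost. *)
Lemma corner_flag (e : R -> H -> H) m : flag M tau e -> (m <= n)%N ->
    op_le (e (m%:R / n.+1%:R)) q ->
  exists2 e', flag N tauN e' & forall i, (i <= n)%N ->
    op_le (corner_ext (e' (i%:R / n%:R))) (e (i.+1%:R / n.+1%:R)) /\
    ((i <= m)%N -> op_le (corner_ext (e' (i%:R / n%:R))) (e (i%:R / n.+1%:R))).
Proof.
move=> fe mn emq.
pose F t := proj_meet q (e t).
have FP (t : R) : 0 <= t <= 1 -> [/\ M (F t), projection (F t), op_le (F t) q & op_le (F t) (e t)].
  move=> t01; have pF := meet_flag_proj fM fe Mq qP t01.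
  split=> //; first exact: (meet_flag_vna fM fe Mq qP t01).
    by apply: proj_fix_le => // x /(meet_flag_fix fM fe Mq qP _ t01)[].
  apply: proj_fix_le => //; first exact: (flag_proj fe).
  by move=> x /(meet_flag_fix fM fe Mq qP _ t01)[].
have nn0 : 0 < (n%:R : R) by rewrite ltr0n.
have nS0 : 0 < (n.+1%:R : R) by rewrite ltr0n.
(* Outside [[0, 1]] nothing is asked of [s], and the witness 0 is arbitrary. *)
have /choice[s sP] : forall t : R, exists s : R, 0 <= t <= 1 ->
    0 <= s <= 1 /\ trace tau (F s) = t * (n%:R / n.+1%:R).
  move=> t; have [t01|] := pselect (0 <= t <= 1); last by exists 0.
  have [t0 t1] := andP t01.
  have [||s s01 ts] := @meet_flag_IVT _ _ _ _ fM e q fe Mq qP (t * (n%:R / n.+1%:R)).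
  - by rewrite mulr_ge0// divr_ge0.
  - by rewrite trq ler_piMl// divr_ge0.
  - by exists s.
have ext_e (t : R) : 0 <= t <= 1 -> corner_ext (compress qP (F (s t))) = F (s t).
  by move=> /sP[/FP[_ pF Fq _] _]; exact: compressE.
exists (fun t => compress qP (F (s t))).
  split=> [t t01|t t' t0 tt' t1|t t01].
  - have [/FP[MF pF _ _] _] := sP t t01.
    split; first exact: (compress_vna qP fM Mq).
    by apply/corner_ext_projection; rewrite ext_e.
  - have t01 : 0 <= t <= 1 by rewrite t0 (le_trans tt').
    have t01' : 0 <= t' <= 1 by rewrite t1 (le_trans t0).
    apply/corner_ext_le; rewrite !ext_e//.
    have [[s01 ts] [s01' ts']] := (sP t t01, sP t' t01').
    apply: (meet_flag_trace_le fM fe Mq qP) => //.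
    by rewrite -/(F _) -/(F _) ts ts' ler_wpM2r// divr_ge0.
  have [s01 ts] := sP t t01; have [MF pF _ _] := FP _ s01.
  rewrite /corner_tau ext_e// (tauE fM MF pF) ts tq -complex_ratio.
  by rewrite -fmorphV -rmorphM/=; congr (_%:C); field; rewrite !gt_eqF//.
move=> i i_n; have i01 := ratio01 i_n n0.
have [s01 ts] := sP _ i01.
have {}ts : trace tau (F (s (i%:R / n%:R))) = i%:R / n.+1%:R.
  by rewrite ts; field; rewrite !gt_eqF.
have below j : (j <= n.+1)%N -> i%:R / n.+1%:R <= trace tau (F (j%:R / n.+1%:R)) ->
    op_le (F (s (i%:R / n%:R))) (e (j%:R / n.+1%:R)).
  move=> jn ij; have j01 := ratio01 jn (ltn0Sn n).
  have [_ _ _] := FP _ j01; apply: op_le_trans.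
  by apply: (meet_flag_trace_le fM fe Mq qP) => //; rewrite -/(F _) ts.
rewrite ext_e//; split=> [|im]; apply: below => //.
- have i1 := ratio01 (i_n : (i.+1 <= n.+1)%N) (ltn0Sn n).
  have := trace_meet_ge fM Mq (flag_vna fe i1) qP (flag_proj fe i1).
  rewrite -/(F _) trq (flag_trace fe i1); apply: le_trans.
  by rewrite -mulrDl -natrD addnS -addSn natrD mulrDl divff ?gt_eqF// addrAC subrr add0r.
- exact: leqW.
have i1 := ratio01 (leqW i_n) (ltn0Sn n); have m1 := ratio01 (leqW mn) (ltn0Sn n).
rewrite -{1}(flag_trace fe i1); have [MF pF _ _] := FP _ i1.
apply: (trace_le fM) => //; [exact: (flag_vna fe)|exact: (flag_proj fe)|].
apply: proj_fix_le => //; first exact: (flag_proj fe).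
move=> x ex; apply/(meet_flag_fix fM fe Mq qP _ i1); split=> //.
apply: (proj_le_fix (flag_proj fe m1) qP emq).
apply: (proj_le_fix (flag_proj fe i1) (flag_proj fe m1)) => //.
have [i0 _] := andP i1; have [_ m1'] := andP m1.
by apply: (flag_le fe) => //; rewrite ler_pM2r ?invr_gt0// ler_nat.
Qed.

(** Passing to [M] multiplies traces by [tau q = n / (n + 1)], turning the bound [l / n] into
    [l / (n + 1)], and a vector in the meet formed in the corner lies in the meet formed in [M]. *)
Lemma corner_meets_flag r (I : rsubset n r) u (e : R -> H -> H) e' p :
    (u <= r)%N -> flag M tau e -> flag N tauN e' -> N p -> projection p ->
    (forall i, (i <= n)%N ->
      op_le (corner_ext (e' (i%:R / n%:R))) (e (i.+1%:R / n.+1%:R)) /\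
      ((i <= ith I u)%N -> op_le (corner_ext (e' (i%:R / n%:R))) (e (i%:R / n.+1%:R)))) ->
  meets_flag tauN e' I p -> meets_flag tau e (raise u I) (corner_ext p).
Proof.
move=> ur fe fe' Np pp e'e meet l lr.
have [l1 lr'] := andP lr.
have iln := ith_le I lr'; have i01 := ratio01 iln n0.
have jln := ith_le (raise u I) lr'; have j01 := ratio01 jln (ltn0Sn n).
have nn0 : 0 < (n%:R : R[i]) by rewrite ltr0n.
have tq_gt0 : 0 < tau q by rewrite tq divr_gt0// ltr0n.
have vN := corner_vna_von_neumann qP fM Mq.
have [Ne' pe'] : N (e' ((ith I l)%:R / n%:R)) /\ projection (e' ((ith I l)%:R / n%:R)).
  by case: fe' => h _ _; exact: h.
(* For [l <= u] the index is not raised, and [ith I l <= ith I u] allows the sharper bound; for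
   [l > u] the index is raised by one. *)
have le_e : op_le (corner_ext (e' ((ith I l)%:R / n%:R))) (e ((ith (raise u I) l)%:R / n.+1%:R)).
  rewrite ith_raise// /hstep; have [h1 h2] := e'e _ iln.
  case: ifPn => lu; last by rewrite addn1.
  by rewrite addn0; apply: h2; exact: ith_mono.
have := meet l lr; rewrite /corner_tau [leRHS]mulrC ler_pdivlMr// => h.
have -> : l%:R / n.+1%:R = l%:R / n%:R * tau q :> R[i].
  by rewrite tq mulrA divfK// gt_eqF.
apply: le_trans h _.
have Nm := meet_vna vN Ne' Np pe' pp; have pm := meet_proj vN Ne' Np pe' pp.
have [Me pe] := (flag_vna fe j01, flag_proj fe j01).
have pxp : projection (corner_ext p) by exact/corner_ext_projection.
apply: (tau_le fM) => //; first exact: (meet_vna vM).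
apply: proj_fix_le; [exact/corner_ext_projection|exact: (meet_proj vM)|] => x.
move=> /corner_ext_fix[qx /(meet_fixE vN Ne' Np pe' pp)[ex px]].
apply/(meet_fixE vM Me Np pe pxp); split; last exact/corner_ext_fix.
apply: (proj_le_fix _ pe le_e); first exact/corner_ext_projection.
exact/corner_ext_fix.
Qed.
End CornerFlag.
End Reduction.

Theorem lemma3p6 (R : realType) (n r : nat) (hr : (1 <= r)%N) (hrn : (r <= n)%N)
    (I J K : rsubset n r) (u v w : nat)
    (hu : (u <= r)%N) (hv : (v <= r)%N) (hw : (w <= r)%N)
    (huvw : (ith I u + ith J v + ith K w <= n)%N) :
  (property_P R I J K -> property_P R (raise u I) (raise v J) (raise w K)) /\
  (property_AP R I J K -> property_AP R (raise u I) (raise v J) (raise w K)).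
Proof.
have n0 : (0 < n)%N := leq_trans hr hrn.
have nn0 : (n%:R : R[i]) != 0 by rewrite pnatr_eq0 -lt0n.
(* The data of the corner, in a form that serves both properties; [ext] will be [corner_ext]. *)
have reduce (H : hilbertSpace R) (M : set (H -> H)) (tau : (H -> H) -> R[i])
    (e f g : R -> H -> H) :
    finite_vna M tau -> diffuse M -> flag M tau e -> flag M tau f -> flag M tau g ->
  exists (H' : hilbertSpace R) (M' : set (H' -> H')) (tau' : (H' -> H') -> R[i])
    (e' f' g' : R -> H' -> H') (ext : (H' -> H') -> H -> H),
  [/\ finite_vna M' tau' /\ diffuse M',
      [/\ flag M' tau' e', flag M' tau' f' & flag M' tau' g'] &
      forall p, M' p -> projection p ->
        [/\ M (ext p), projection (ext p), tau (ext p) = n%:R / n.+1%:R * tau' p &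
          [/\ meets_flag tau' e' I p -> meets_flag tau e (raise u I) (ext p),
              meets_flag tau' f' J p -> meets_flag tau f (raise v J) (ext p) &
              meets_flag tau' g' K p -> meets_flag tau g (raise w K) (ext p)]]].
  move=> fM dM fe ff fg.
  have [q [Mq pq tq [eq fq gq]]] := flag_join_le fM fe ff fg huvw.
  have tq0 : tau q != 0 by rewrite tq mulf_neq0// invr_eq0 pnatr_eq0.
  have [e' fe' he'] := corner_flag fM pq Mq n0 tq fe (ith_le I hu) eq.
  have [f' ff' hf'] := corner_flag fM pq Mq n0 tq ff (ith_le J hv) fq.
  have [g' fg' hg'] := corner_flag fM pq Mq n0 tq fg (ith_le K hw) gq.
  exists (corner_space pq), (corner_vna pq M), (corner_tau pq tau), e', f', g'.
  exists (@corner_ext _ _ _ pq); split=> //.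
    by split; [exact: (corner_finite_vna pq fM Mq tq0)|exact: (corner_diffuse fM Mq dM)].
  move=> p Np pp; split=> //.
  - exact/corner_ext_projection.
  - by rewrite /corner_tau -tq mulVKf.
  split.
  - exact: (corner_meets_flag fM Mq n0 tq hu fe fe' Np pp he').
  - exact: (corner_meets_flag fM Mq n0 tq hv ff ff' Np pp hf').
  - exact: (corner_meets_flag fM Mq n0 tq hw fg fg' Np pp hg').
have ratio : n%:R / n.+1%:R * (r%:R / n%:R) = r%:R / n.+1%:R :> R[i].
  by rewrite mulrC mulrA divfK.
split=> [IJK|IJK] H M tau fM dM e f g fe ff fg.
  have [H' [M' [tau' [e' [f' [g' [ext [[fM' dM'] [fe' ff' fg'] extP]]]]]]]] :=
    reduce H M tau e f g fM dM fe ff fg.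
  have [p [Mp pp tp [ep fp gp]]] := IJK H' M' tau' fM' dM' e' f' g' fe' ff' fg'.
  have [Mx px tx [ex fx gx]] := extP p Mp pp.
  exists (ext p); split=> //; first by rewrite tx tp.
  by split; [exact: ex|exact: fx|exact: gx].
move=> eps eps0.
have [H' [M' [tau' [e' [f' [g' [ext [[fM' dM'] [fe' ff' fg'] extP]]]]]]]] :=
  reduce H M tau e f g fM dM fe ff fg.
have [p [Mp pp tp [ep fp gp]]] := IJK H' M' tau' fM' dM' e' f' g' fe' ff' fg' eps eps0.
have [Mx px tx [ex fx gx]] := extP p Mp pp.
exists (ext p); split=> //; last by split; [exact: ex|exact: fx|exact: gx].
(* The error becomes [eps * n / (n + 1)], at most [eps], so the same [eps] is used in the corner. *)
rewrite tx; apply: (@le_trans _ _ (n%:R / n.+1%:R * (r%:R / n%:R + eps%:C))).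
  by rewrite ler_wpM2l// divr_ge0.
rewrite mulrDr ratio lerD2l ler_piMl//; first by rewrite ler0c ltW.
by rewrite ler_pdivrMr ?ltr0n// mul1r ler_nat.
Qed.
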